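(* For every $d\ge 1$, $$\lim_{g\to\infty}\frac{N(g,d)}{4\sqrt3\,(g+0.5)^2\,\pi}\le 1 .$$
   Context: For $d\ge 1$ let $\mathcal{G}_d$ be the set of all lattices in the Euclidean plane $E^2$ such that (1) any two distinct vertices have distance at least $d$; (2) the area of each parallelogram that is a fundamental domain for the lattice is at least $d^2\sqrt 3$; (3) the origin of $E^2$ is a vertex. A non-zero vertex of a lattice is primitive if it is not a positive integral multiple of any other vertex. With $D(R)$ the disc of radius $R$ centered at the origin, $$N(g,d)=\frac12\max_{\Gamma\in\mathcal{G}_d}\#\{\text{primitive vertices of }\Gamma\text{ in }D(2g\pi)\}.$$ *)

(* Defs.v *)
From HB Require Import structures.
From mathcomp Require Import all_boot all_order all_algebra.
From mathcomp Require Import finmap.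
From mathcomp Require Import all_classical all_reals all_analysis.

Set Implicit Arguments.
Unset Strict Implicit.
Unset Printing Implicit Defensive.
Import Order.TTheory GRing.Theory Num.Theory.
Import numFieldNormedType.Exports.
Local Open Scope classical_set_scope.
Local Open Scope ring_scope.

(* The norm that the library puts on 'rV[R]_2 is the sup norm, so the
   Euclidean norm is written out. *)
Definition enorm (R : realType) (x : 'rV[R]_2) : R :=
  Num.sqrt (\sum_i x ord0 i ^+ 2).

Definition disc (R : realType) (r : R) : set 'rV[R]_2 :=
  [set x | enorm x <= r].

(* The area of the parallelogram with edge vectors u and v. *)
Definition area (R : realType) (u v : 'rV[R]_2) : R :=
  `| \det (col_mx u v : 'M[R]_2) |.

(* A lattice is identified with its set of vertices; it need not contain the
   origin. *)
Definition is_lattice (R : realType) (L : set 'rV[R]_2) : Prop :=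
  exists p u v : 'rV[R]_2,
    area u v != 0 /\
    L = [set x | exists m n : int, x = p + u *~ m + v *~ n].

Definition translations (R : realType) (L : set 'rV[R]_2) : set 'rV[R]_2 :=
  [set t | [set x + t | x in L] = L].

(* Half-open, so that a tiling by translates has no overlap at all. *)
Definition parallelogram (R : realType) (p u v : 'rV[R]_2) : set 'rV[R]_2 :=
  [set x | exists s t : R,
    [/\ 0 <= s < 1, 0 <= t < 1 & x = p + s *: u + t *: v]].

Definition fundamental_domain (R : realType) (L D : set 'rV[R]_2) : Prop :=
  forall x, exists! t, translations L t /\ D (x - t).

Definition lattices (R : realType) (d : R) : set (set 'rV[R]_2) :=
  [set L | [/\ is_lattice L,
    (forall x y, L x -> L y -> x != y -> d <= enorm (x - y)),
    (forall p u v, area u v != 0 ->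
       fundamental_domain L (parallelogram p u v) ->
       d ^+ 2 * Num.sqrt 3 <= area u v)
    & L 0]].

Definition primitive (R : realType) (L : set 'rV[R]_2) : set 'rV[R]_2 :=
  [set x | [/\ L x, x != 0 &
    forall (y : 'rV[R]_2) (n : nat), L y -> y != x -> (0 < n)%N ->
      x != y *+ n]].

(* fset_set is the empty set on infinite arguments; this does not happen for a
   lattice, whose vertices in a disc are finite in number. *)
Definition num_primitive (R : realType) (L : set 'rV[R]_2) (r : R) : nat :=
  #|` fset_set (primitive L `&` disc r)|.

(* The default value 0 is used only if A has no greatest element. *)
Definition max_nat (A : set nat) : nat := xget 0%N (A `&` ubound A).

(* The maximum exists: lattices d is nonempty and, as distinct vertices are at
   distance at least d, the counts are bounded in terms of g and d. *)
Definition N (R : realType) (g d : R) : R :=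
  2^-1 * (max_nat [set num_primitive L (2 * g * pi) | L in lattices d])%:R.

(* Main.v *)
Require Import Defs.
From mathcomp Require Import all_boot all_order all_algebra.
From mathcomp Require Import finmap.
From mathcomp Require Import all_classical all_reals all_analysis.
From mathcomp Require Import ring lra zify.
Set Implicit Arguments.
Unset Strict Implicit.
Unset Printing Implicit Defensive.
Import Order.TTheory GRing.Theory Num.Theory.
Import numFieldNormedType.Exports.
Local Open Scope classical_set_scope.
Local Open Scope ring_scope.

(** The limit exists and equals pi^2 / (6 d^2 zeta(2)), which is at most 1
    because zeta(2) >= pi^2/6 and d >= 1.

    A lattice of covolume A has about pi r^2 / A vertices in the disc of radius r,
    and a proportion 1/zeta(2) of them is primitive, since the vertices other
    than the origin are the disjoint union over k of k times the set of primitive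
    vertices ([disc_count_primitive]). As A >= d^2 sqrt 3 for the lattices under
    consideration ([lattices_grid]), with equality for a rectangular lattice
    ([rect_lattices]), the maximal count is asymptotic to
    pi r^2 / (d^2 sqrt 3 zeta(2)), provided that the estimates hold uniformly over
    all the lattices. The limit follows with r = 2 g pi.

    Uniformity for the count of all vertices comes from a nearly reduced basis:
    as distances are at least 1, both the spacing of the vertices on a row and
    the distance of consecutive rows are bounded below, so that counting row by
    row makes an error of order r ([separated_disc_count]). The total length of
    the rows is a Riemann sum for the area of the disc ([chord_sum]).

    To pass from all vertices to the primitive ones, Moebius inversion is
    replaced by an iteration. If e(r) is the deviation of the primitive count from
    its expected value, then e(r) + e(r/2) + e(r/3) + ... = O(r). A bound
    |e(r)| <= E r^2 + M for all r implies that the terms from the second one on add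
    up to at most (zeta(2) - 1) E r^2 + O(r), hence a similar bound for e(r) with a
    smaller E ([primitive_error_contract]). So E can be made arbitrarily small.

    That the rectangular lattice satisfies the condition on areas requires
    a bound for all of its fundamental parallelograms, including those whose sides
    are not lattice vectors: one that tiles the plane by lattice translations maps
    the grid spanned by its own sides into the lattice, injectively and up to a
    bounded displacement, so that this grid is not denser than the lattice
    ([area_fundamental]).

    Finally zeta(2) >= pi^2/6 comes from summing 1/sin^2 over the odd multiples of
    pi/2^(n+2), where the duplication formula gives the exact value
    ([csc2_sumE]), and from cot x <= 1/x ([zeta2_ge]). *)

(** * Odd squares: a lower bound for the sum of their inverses *)

Lemma ge0_derive_incr (R : realType) (f df : R -> R) (a b : R) : a <= b ->
  (forall x : R, is_derive x 1 f (df x)) ->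
  (forall x, a <= x <= b -> 0 <= df x) -> f a <= f b.
Proof.
move=> ab fE df0.
have [|c + E] := @MVT_segment R f df a b ab (fun x _ => fE x).
  apply: derivable_within_continuous => x _.
  exact: (@ex_derive _ _ _ _ _ _ _ (fE x)).
rewrite in_itv /= => /df0 dfc.
by rewrite -subr_ge0 E mulr_ge0 // subr_ge0.
Qed.

Lemma xcos_le_sin (R : realType) (x : R) : 0 <= x <= pi / 2 -> x * cos x <= sin x.
Proof.
move=> /andP[x0 xpi].
have := @ge0_derive_incr R (fun t => sin t - t * cos t) (fun t => t * sin t) 0 x x0.
rewrite sin0 mul0r subr0 subr_ge0; apply.
- move=> t; apply: is_derive_eq; rewrite /GRing.scale /=; ring.
- move=> t /andP[t0 tx]; apply: mulr_ge0 => //; apply: sin_ge0_pi.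
  have := @pi_ge0 R; lra.
Qed.

(** This is cot x <= 1/x, squared: 1/sin^2 x = 1 + cot^2 x. *)
Lemma inv_sqr_sin_le (R : realType) (x : R) : 0 < x < pi / 2 ->
  (sin x ^+ 2)^-1 <= (x ^+ 2)^-1 + 1.
Proof.
move=> /andP[x0 xpi].
have sx : 0 < sin x by apply: sin_gt0_pihalf; rewrite x0.
have cx : 0 <= cos x by apply: cos_ge0_pihalf; have := @pi_ge0 R; lra.
have le : x * cos x <= sin x by apply: xcos_le_sin; rewrite !ltW.
have le2 : x ^+ 2 * cos x ^+ 2 <= sin x ^+ 2.
  by rewrite -exprMn ler_sqr ?nnegrE // ?mulr_ge0 // ltW.
have x2 : 0 < x ^+ 2 by rewrite exprn_gt0.
rewrite -[X in _ <= _ + X](@divff R (x ^+ 2)) ?gt_eqF // -[X in X + _]mul1r -mulrDl.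
rewrite -[X in X <= _]mul1r ler_pdivrMr ?exprn_gt0 // mulrAC ler_pdivlMr //.
have := cos2Dsin2 x; nra.
Qed.

Lemma sum_fold_ends (V : zmodType) (F : nat -> V) (N : nat) :
  \sum_(0 <= k < N + N) F k = \sum_(0 <= k < N) (F k + F (N + N - k.+1)%N).
Proof.
rewrite (big_cat_nat (n := N)) ?leq_addr //= big_split /=; congr (_ + _).
rewrite [LHS]big_nat_rev /= -{1}[N]add0n big_addn addnK.
by apply: eq_big_nat => k /andP[_ kN]; congr F; lia.
Qed.

(** The sum of 1/sin^2 over the odd multiples of pi/2^(n+2) in ]0, pi/2[. Halving
    the angles has a simple effect on it, which gives its value in closed form. *)
Definition csc2_sum (R : realType) (n : nat) : R :=
  \sum_(0 <= k < 2 ^ n) (sin ((2 * k%:R + 1) * pi / 2 ^+ n.+2) ^+ 2)^-1.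

Lemma csc2_double (R : realType) (y : R) : sin y != 0 -> cos y != 0 ->
  (sin y ^+ 2)^-1 + (sin (pi / 2 - y) ^+ 2)^-1 = 4 * (sin (y *+ 2) ^+ 2)^-1.
Proof.
move=> s0 c0.
have -> : sin (pi / 2 - y) = cos y.
  by rewrite sinB sin_pihalf cos_pihalf mul1r mul0r subr0.
rewrite sin_mulr2n -mulr_natl.
have := cos2Dsin2 y => E.
have -> : (sin y ^+ 2)^-1 + (cos y ^+ 2)^-1 = (cos y ^+ 2 + sin y ^+ 2) / (sin y ^+ 2 * cos y ^+2).
  by field; rewrite s0 c0.
rewrite E; field; by rewrite s0 c0.
Qed.

Lemma csc2_sum_bounds (R : realType) (n k : nat) : (k < 2 ^ n)%N ->
  0 < (2 * k%:R + 1) * (pi : R) / 2 ^+ n.+2 < pi / 2.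
Proof.
move=> kn.
have p0 := @pi_gt0 R.
have P0 : 0 < (2 : R) ^+ n.+2 by rewrite exprn_gt0.
apply/andP; split.
  by rewrite divr_gt0 // mulr_gt0 //; have := ler0n R k; lra.
rewrite ltr_pdivrMr // mulrC !exprS -!mulrA ltr_pM2l //.
rewrite mulKf ?pnatr_eq0 //.
have : k.+1%:R <= (2 : R) ^+ n by rewrite -natrX ler_nat.
rewrite -natr1; lra.
Qed.

(** Each step replaces an angle 2y by the pair y, pi/2 - y, which multiplies the
    sum by 4; the two members of a pair are the terms k and 2^(n+1) - 1 - k of
    the longer sum. *)
Lemma csc2_sumE (R : realType) (n : nat) : csc2_sum R n = 2 * 4 ^+ n.
Proof.
elim: n => [|n IH].
  rewrite /csc2_sum expn0 big_nat1 mulr0 add0r mul1r expr0 mulr1.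
  have -> : (pi : R) / 2 ^+ 2 = pi / 4 by congr (_ / _); ring.
  have p0 := @pi_gt0 R.
  have c0 : cos ((pi : R) / 4) != 0.
    by rewrite gt_eqF // cos_gt0_pihalf //; apply/andP; split; lra.
  have : cos ((pi : R) / 4) = sin (pi / 4).
    have /(congr1 ( *%R^~ (cos (pi / 4)))) := tan_piquarter R.
    by rewrite /tan mul1r mulfVK.
  have := cos2Dsin2 ((pi : R) / 4) => E Ec; rewrite Ec in E.
  have -> : sin ((pi : R) / 4) ^+ 2 = 2^-1 by lra.
  by rewrite invrK.
rewrite exprS mulrCA -IH /csc2_sum expnS mul2n -addnn sum_fold_ends.
rewrite mulr_sumr; apply: eq_big_nat => k /andP[_ kn].
have kn1 : (k < 2 ^ n.+1)%N by rewrite expnS mul2n -addnn ltn_addr.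
have /andP[y0 ypi] := csc2_sum_bounds R kn1.
set y := (_ * pi / 2 ^+ n.+3) in y0 ypi *.
have P0 : (2 : R) ^+ n != 0 by rewrite expf_neq0.
have -> : (2 * k%:R + 1) * pi / 2 ^+ n.+2 = y *+ 2.
  by rewrite /y !exprS -mulr_natl; field.
rewrite -csc2_double; last 2 first.
- by rewrite gt_eqF // sin_gt0_pihalf // y0.
- by rewrite gt_eqF // cos_gt0_pihalf // ypi andbT; lra.
congr (_ + (sin _ ^+ 2)^-1).
rewrite natrB ?addnn; last by rewrite -mul2n -expnS.
rewrite -addnn natrD natrX -natr1 /y !exprS; field.
by rewrite P0.
Qed.

(** The bound 1/x^2 >= 1/sin^2 x - 1 on the terms of [csc2_sum], whose 2^n
    corrections by 1 are negligible against its value 2 * 4^n. *)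
Lemma odd_squares_ge (R : realType) (n : nat) :
  (pi : R) ^+ 2 / 8 * (1 - (2 ^+ n.+1)^-1) <=
  \sum_(0 <= k < 2 ^ n) ((2 * k%:R + 1) ^+ 2)^-1.
Proof.
have p0 := @pi_gt0 R.
have P0 : 0 < (2 : R) ^+ n by rewrite exprn_gt0.
have := csc2_sumE R n.
have : csc2_sum R n <= \sum_(0 <= k < 2 ^ n)
    (16 * (2 ^+ n) ^+ 2 / pi ^+ 2 * ((2 * k%:R + 1) ^+ 2)^-1 + 1).
  rewrite /csc2_sum !big_nat; apply: ler_sum => k /andP[_ kn].
  apply: (le_trans (inv_sqr_sin_le (csc2_sum_bounds R kn))).
  rewrite lerD2r le_eqVlt; apply/orP; left; apply/eqP.
  rewrite !exprS expr0; field.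
  have k0 := ler0n R k.
  by rewrite !gt_eqF //; lra.
rewrite big_split /= -mulr_sumr sumr_const_nat subn0 natrX => + E.
rewrite E -lerBlDr -ler_pdivrMl ?divr_gt0 ?mulr_gt0 ?exprn_gt0 //.
apply: le_trans; rewrite le_eqVlt; apply/orP; left; apply/eqP.
have -> : (4 : R) ^+ n = (2 ^+ n) ^+ 2 by rewrite exprAC; congr (_ ^+ _); ring.
move: p0; move: (pi : R) => p p0; rewrite !exprS expr0; field.
by rewrite !gt_eqF.
Qed.

(** * The sum of the inverse squares *)

Definition sqr_sum (R : realType) (n : nat) : R :=
  \sum_(0 <= k < n) (k.+1%:R ^+ 2)^-1.

Lemma sqr_sumS (R : realType) (n : nat) :
  sqr_sum R n.+1 = sqr_sum R n + (n.+1%:R ^+ 2)^-1.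
Proof. by rewrite /sqr_sum big_nat_recr. Qed.

Lemma sqr_sum_incr (R : realType) (m n : nat) : (m <= n)%N ->
  sqr_sum R m <= sqr_sum R n.
Proof.
move=> /subnKC <-; elim: (n - m)%N => [|j IH]; first by rewrite addn0.
by rewrite addnS sqr_sumS (le_trans IH) // lerDl invr_ge0 exprn_ge0.
Qed.

(** Telescoping: 1/(n+1)^2 <= 1/n - 1/(n+1). *)
Lemma sqr_sum_tail (R : realType) (m n : nat) : (0 < n)%N ->
  sqr_sum R m <= sqr_sum R n + n%:R^-1.
Proof.
move=> n0; have [mn|/ltnW nm] := leqP m n.
  by rewrite (le_trans (sqr_sum_incr R mn)) // lerDl invr_ge0.
suff : sqr_sum R m + m%:R^-1 <= sqr_sum R n + n%:R^-1.
  by apply: le_trans; rewrite lerDl invr_ge0.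
move: nm => /subnKC <-; elim: (m - n)%N => [|j IH]; first by rewrite addn0.
rewrite addnS sqr_sumS; apply: le_trans IH; rewrite -addrA lerD2l.
have k0 : 0 < (n + j)%:R :> R by rewrite ltr0n addn_gt0 n0.
rewrite -natr1; move: (_%:R) k0 => x x0.
rewrite -subr_ge0.
have -> : x^-1 - (((x + 1) ^+ 2)^-1 + (x + 1)^-1) = (x * (x + 1) ^+ 2)^-1.
  by field; rewrite !gt_eqF //; lra.
by rewrite invr_ge0 mulr_ge0 ?sqr_ge0 // ltW.
Qed.

Definition zeta2 (R : realType) : R := sup (range (sqr_sum R)).

Lemma sqr_sum_has_sup (R : realType) : has_sup (range (sqr_sum R)).
Proof.
split; first by exists (sqr_sum R 0); exists 0%N.
exists (sqr_sum R 1 + 1%:R^-1) => _ [m _ <-]; exact: sqr_sum_tail.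
Qed.

Lemma sqr_sum_le_zeta2 (R : realType) (n : nat) : sqr_sum R n <= zeta2 R.
Proof.
by apply: ub_le_sup; [case: (sqr_sum_has_sup R) | exists n].
Qed.

Lemma zeta2_le_sqr_sum (R : realType) (n : nat) : (0 < n)%N ->
  zeta2 R <= sqr_sum R n + n%:R^-1.
Proof.
move=> n0; apply: sup_le_ub => [|_ [m _ <-]]; last exact: sqr_sum_tail.
by case: (sqr_sum_has_sup R).
Qed.

Lemma zeta2_ge1 (R : realType) : 1 <= zeta2 R.
Proof.
have := sqr_sum_le_zeta2 R 1; rewrite /sqr_sum big_nat1; lra.
Qed.

Lemma zeta2_le (R : realType) : zeta2 R <= 7 / 4.
Proof.
have := zeta2_le_sqr_sum R (isT : (0 < 2)%N).
rewrite /sqr_sum big_nat_recr //= big_nat1; lra.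
Qed.

Lemma sqr_sum_double (R : realType) (N : nat) :
  sqr_sum R (N + N) =
  \sum_(0 <= k < N) ((2 * k%:R + 1) ^+ 2)^-1 + sqr_sum R N / 4.
Proof.
elim: N => [|N IH]; first by rewrite /sqr_sum !big_geq // mul0r addr0.
rewrite addnS addSn 2!sqr_sumS IH sqr_sumS big_nat_recr //= [X in _ = _ + X]mulrDl.
have -> : (N + N).+1%:R = 2 * N%:R + 1 :> R by rewrite -natr1 natrD; ring.
have -> : (N + N).+2%:R = 2 * N.+1%:R :> R by rewrite -!natr1 natrD; ring.
have -> : ((2 * N.+1%:R) ^+ 2)^-1 = (N.+1%:R ^+ 2)^-1 / 4 :> R.
  by rewrite exprMn invfM mulrC; congr (_ / _); ring.
by rewrite -!addrA; congr (_ + _); rewrite addrCA.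
Qed.

Lemma le_of_pow2_error (R : realType) (a b C : R) :
  (forall n, a - C / 2 ^+ n <= b) -> a <= b.
Proof.
move=> H; rewrite leNgt; apply/negP => ba.
have ab : 0 < a - b by rewrite subr_gt0.
have C0 : 0 <= `|C| by [].
pose n := (Num.truncn (`|C| / (a - b))).+1.
have : `|C| / (a - b) < n%:R by apply: truncnS_gt.
rewrite ltr_pdivrMr // => Cn.
have n2 : n%:R <= (2 : R) ^+ n by rewrite -natrX ler_nat ltnW // ltn_expl.
have P0 : 0 < (2 : R) ^+ n by rewrite exprn_gt0.
have := H n; rewrite lerBlDr -lerBlDl ler_pdivlMr // => H1.
have := ler_norm C; nra.
Qed.

(** The sum over the even integers is a quarter of the whole sum, so the sum
    over the odd ones, at least pi^2/8, is three quarters of it. *)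
Lemma zeta2_ge (R : realType) : (pi : R) ^+ 2 / 6 <= zeta2 R.
Proof.
suff : (pi : R) ^+ 2 / 8 <= 3 / 4 * zeta2 R by lra.
apply: (@le_of_pow2_error _ _ _ ((pi : R) ^+ 2 / 16 + 4^-1)) => n.
have := sqr_sum_le_zeta2 R (2 ^ n + 2 ^ n); rewrite sqr_sum_double.
have := odd_squares_ge R n.
have := @zeta2_le_sqr_sum R (2 ^ n); rewrite expn_gt0 natrX => /(_ isT).
rewrite [2 ^+ n.+1]exprS invfM.
move: (\sum_(_ <= _ < _) _) (sqr_sum _ _) ((2 ^+ n)^-1) => O H t; lra.
Qed.

(** * Riemann sums for the area of the disc *)

Definition chord (R : realType) (x : R) : R := Num.sqrt (1 - x ^+ 2).

(** The area under the unit circle between the abscissae 0 and sin t. *)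
Definition sector_area (R : realType) (t : R) : R := (t + sin t * cos t) / 2.

Lemma cos_nonincr (R : realType) (x y : R) :
  0 <= x -> x <= y -> y <= pi -> cos y <= cos x.
Proof.
move=> x0; rewrite le_eqVlt => /orP[/eqP->//|xy] ypi.
by rewrite ltW // ltr_cos // in_itv /=; lra.
Qed.

(** The area between two abscissae lies between those of two rectangles whose
    heights are the ordinates at the ends. *)
Lemma sector_area_incr (R : realType) (x y : R) :
  0 <= x -> x <= y -> y <= pi / 2 ->
  (sin y - sin x) * cos y <= sector_area y - sector_area x
                          <= (sin y - sin x) * cos x.
Proof.
move=> x0 xy ypi; have p0 := @pi_gt0 R.
have dS (t : R) : is_derive t 1 (@sector_area R) (cos t ^+ 2).
  have -> : @sector_area R = (fun s => 2^-1 * (s + sin s * cos s)).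
    by apply/funext => s; rewrite /sector_area mulrC.
  apply: is_derive_eq; rewrite /GRing.scale /=.
  by have := cos2Dsin2 t; lra.
have c0 (t : R) : x <= t <= y -> 0 <= cos t.
  by move=> ?; apply: cos_ge0_pihalf; lra.
apply/andP; split.
- suff : sector_area x - sin x * cos y <= sector_area y - sin y * cos y by lra.
  apply: (@ge0_derive_incr R (fun t => sector_area t - sin t * cos y)
    (fun t => cos t ^+ 2 - cos t * cos y)) => //.
    move=> t; apply: is_derive_eq; rewrite /GRing.scale /=; ring.
  move=> t txy; rewrite expr2 -mulrBr mulr_ge0 ?c0 // subr_ge0.
  by apply: cos_nonincr; lra.
- suff : sin x * cos x - sector_area x <= sin y * cos x - sector_area y by lra.
  apply: (@ge0_derive_incr R (fun t => sin t * cos x - sector_area t)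
    (fun t => cos t * cos x - cos t ^+ 2)) => //.
    move=> t; apply: is_derive_eq; rewrite /GRing.scale /=; ring.
  move=> t txy; rewrite expr2 -mulrBr mulr_ge0 ?c0 // subr_ge0.
  by apply: cos_nonincr; lra.
Qed.

(** The area under the unit circle between the abscissae 0 and x, constant
    beyond 1. *)
Definition chord_prim (R : realType) (x : R) : R :=
  sector_area (asin (Num.min x 1)).

Lemma asin_incr (R : realType) (x y : R) : -1 <= x -> x <= y -> y <= 1 ->
  asin x <= asin y.
Proof.
move=> x0 xy y1; rewrite leNgt; apply/negP => yx.
have [X Y] : -1 <= x <= 1 /\ -1 <= y <= 1 by split; lra.
have : sin (asin y) < sin (asin x).
  by rewrite ltr_sin // in_itv /= ?asin_geNpi2 ?asin_lepi2.
by rewrite !asinK ?in_itv //= ltNge xy.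
Qed.

Lemma asin0 (R : realType) : asin 0 = 0 :> R.
Proof.
have p0 := @pi_gt0 R.
by rewrite -[X in asin X]sin0 sinK // in_itv /=; lra.
Qed.

Lemma asin1 (R : realType) : asin 1 = pi / 2 :> R.
Proof.
have p0 := @pi_gt0 R.
by rewrite -[X in asin X]sin_pihalf sinK // in_itv /=; lra.
Qed.

Lemma chord_ge1 (R : realType) (x : R) : 1 <= x -> chord x = 0.
Proof. by move=> x1; apply: ler0_sqrtr; nra. Qed.

Lemma chord_prim_incr (R : realType) (x y : R) : 0 <= x -> x <= y ->
  (y - x) * chord y <= chord_prim y - chord_prim x <= (y - x) * chord x.
Proof.
move=> x0 xy.
have H (a b : R) : 0 <= a -> a <= b -> b <= 1 ->
    (b - a) * chord b <= chord_prim b - chord_prim a <= (b - a) * chord a.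
  move=> a0 ab b1.
  rewrite /chord_prim !min_l //; last by lra.
  have [A B] : -1 <= a <= 1 /\ -1 <= b <= 1 by split; lra.
  have := @sector_area_incr R (asin a) (asin b).
  rewrite !asinK ?in_itv //= !cos_asin //; apply.
  - by rewrite -asin0 asin_incr //; lra.
  - by apply: asin_incr; lra.
  - by apply: asin_lepi2.
have P1 (z : R) : 1 <= z -> chord_prim z = chord_prim 1.
  by move=> z1; rewrite /chord_prim !min_r.
have [y1|y1] := leP y 1; first exact: H.
have [x1|x1] := leP x 1; last first.
  by rewrite (P1 y (ltW y1)) (P1 x (ltW x1))
    (chord_ge1 (ltW x1)) (chord_ge1 (ltW y1)) !mulr0 subrr lexx.
have /andP[H1 H2] := H x 1 x0 x1 (lexx _).
rewrite (P1 y (ltW y1)) (chord_ge1 (ltW y1)) mulr0; move: H1.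
rewrite chord_ge1 // mulr0 => -> /=; apply: (le_trans H2).
by rewrite ler_wpM2r ?sqrtr_ge0 // lerD2r ltW.
Qed.

Lemma chord_prim0 (R : realType) : chord_prim (0 : R) = 0.
Proof.
by rewrite /chord_prim min_l // asin0 /sector_area sin0 mul0r add0r mul0r.
Qed.

Lemma chord_prim_ge1 (R : realType) (x : R) : 1 <= x -> chord_prim x = pi / 4.
Proof.
move=> x1; rewrite /chord_prim min_r // asin1 /sector_area cos_pihalf.
by rewrite mulr0 addr0 -mulrA -invfM; congr (_ / _); ring.
Qed.

(** As [chord] is nonincreasing, the quarter disc, of area pi/4, lies between its
    upper and lower Riemann sums of step t, which differ by t. *)
Lemma chord_sum (R : realType) (t : R) (n : nat) : 0 < t -> 1 <= n%:R * t ->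
  pi / 4 - t <= t * \sum_(0 <= j < n) chord (j.+1%:R * t) <= pi / 4.
Proof.
move=> t0 nt1.
have step (j : nat) : t * chord (j.+1%:R * t) <=
    chord_prim (j.+1%:R * t) - chord_prim (j%:R * t) <= t * chord (j%:R * t).
  have := @chord_prim_incr R (j%:R * t) (j.+1%:R * t).
  have -> : j.+1%:R * t - j%:R * t = t by rewrite -natr1; ring.
  by apply; [rewrite mulr_ge0 // ltW | rewrite ler_pM2r // ler_nat].
have tele : \sum_(0 <= j < n)
    (chord_prim (j.+1%:R * t) - chord_prim (j%:R * t)) = pi / 4.
  by rewrite telescope_sumr // mul0r chord_prim0 subr0 chord_prim_ge1.
have c1 : chord (0 : R) = 1 by rewrite /chord expr0n subr0 sqrtr1.
have lo : pi / 4 <= t * \sum_(0 <= j < n) chord (j%:R * t).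
  rewrite -tele mulr_sumr; apply: ler_sum => j _.
  by case/andP: (step j).
have up : t * \sum_(0 <= j < n) chord (j.+1%:R * t) <= pi / 4.
  rewrite -tele mulr_sumr; apply: ler_sum => j _.
  by case/andP: (step j).
rewrite up andbT lerBlDr; apply: (le_trans lo).
have E : \sum_(0 <= j < n) chord (j%:R * t) <= 1 + \sum_(0 <= j < n) chord (j.+1%:R * t).
  case: (n) nt1 => [|m _]; first by rewrite !big_geq // addr0.
  rewrite big_nat_recl // mul0r c1 lerD2l [leRHS]big_nat_recr //= lerDl.
  exact: sqrtr_ge0.
by rewrite addrC -[X in X + _]mulr1 -mulrDr ler_pM2l.
Qed.

(** * Counting the points of a set *)

Definition cnt (T : choiceType) (A : set T) : nat := #|` fset_set A|.

Lemma cnt_le (T : choiceType) (A B : set T) : finite_set B -> A `<=` B ->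
  (cnt A <= cnt B)%N.
Proof.
move=> fB AB; apply: fsubset_leq_card; rewrite -fset_set_sub //.
exact: sub_finite_set fB.
Qed.

Lemma cnt_image (T U : choiceType) (f : T -> U) (A : set T) : finite_set A ->
  {in A &, injective f} -> cnt (f @` A) = cnt A.
Proof.
move=> fA fi; rewrite /cnt fset_set_image // card_in_imfset //= => x y.
by rewrite !in_fset_set // => xA yA; apply: fi.
Qed.

Lemma cnt_fibers (T : choiceType) (A : set T) (f : T -> nat) (K : nat) :
  finite_set A -> (forall x, A x -> (f x < K)%N) ->
  cnt A = (\sum_(0 <= k < K) cnt (A `&` [set x | f x = k]))%N.
Proof.
move=> fA fK.
have fI k : finite_set (A `&` [set x | f x = k]) by apply: finite_setIl.
transitivity (\sum_(0 <= k < K) \sum_(x <- fset_set A) (f x == k))%N.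
  rewrite exchange_big /= /cnt card_fset_sum1 /= [LHS]big_seq [RHS]big_seq.
  apply: eq_bigr => x; rewrite in_fset_set // inE => Ax.
  rewrite big_mkord (bigD1 (Ordinal (fK x Ax))) //= eqxx big1 ?addn0 // => i.
  by rewrite -val_eqE /= eq_sym => /negbTE ->.
apply: eq_bigr => k _; rewrite /cnt card_fset_sum1 /=.
rewrite -big_mkcond /= -big_filter; apply: perm_big.
apply: uniq_perm; rewrite ?filter_uniq ?fset_uniq // => x.
rewrite mem_filter !in_fset_set //.
apply/andP/idP => [[/eqP fx]|]; rewrite !inE /=; first by move=> Ax; split.
by case=> Ax /eqP.
Qed.

Lemma int_segment_image (lo : int) (n : nat) :
  [set m : int | lo <= m < lo + n%:Z] = (fun i : nat => lo + i%:Z) @` `I_n.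
Proof.
apply/seteqP; split => [m /= /andP[lm mn]|_ [i /= ilt <-]].
  exists `|m - lo|%N; rewrite /=; last by lia.
  lia.
by lia.
Qed.

Lemma cnt_int_segment (lo : int) (n : nat) :
  cnt [set m : int | lo <= m < lo + n%:Z] = n.
Proof.
rewrite int_segment_image cnt_image //; first last.
- by move=> i j _ _ /addrI [].
- by rewrite /cnt fset_set_II card_imfset ?size_enum_ord //=; exact: val_inj.
Qed.

(** A real segment of length l contains between l - 1 and l + 1 integers. *)
Lemma cnt_line (R : realType) (a c s : R) : 0 < a ->
  let A := [set m : int | (m%:~R * a + c) ^+ 2 <= s] in
  finite_set A /\ `|(cnt A)%:R - 2 * Num.sqrt s / a| <= 1.
Proof.
move=> a0 A; have [s0|s0] := ltP s 0.
  have -> : A = set0.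
    apply/seteqP; split => // m /= /le_lt_trans /(_ s0).
    by rewrite ltNge sqr_ge0.
  by rewrite /cnt fset_set0 /= ltr0_sqrtr // mulr0 mul0r subrr normr0.
set w := Num.sqrt s.
have w0 : 0 <= w by exact: sqrtr_ge0.
pose x : R := (- w - c) / a; pose y : R := (w - c) / a.
have xy : x <= y by rewrite ler_pM2r ?invr_gt0 //; lra.
have lohi : Num.ceil x <= Num.floor y + 1.
  by rewrite -lerBlDr floor_ge_int (le_trans _ xy) // ltW // ceilB1_lt.
pose n := `|(Num.floor y + 1 - Num.ceil x)%R|%N.
have nE : n%:Z = Num.floor y + 1 - Num.ceil x by rewrite gez0_abs // subr_ge0.
have AE : A = [set m : int | Num.ceil x <= m < Num.ceil x + n%:Z].
  apply/seteqP; rewrite /A; split => m /=; rewrite nE subrKC ltzD1 ceil_le_int floor_ge_int;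
    rewrite ler_pdivrMr // ler_pdivlMr // -(sqr_sqrtr s0) -/w.
    by rewrite -real_normK ?num_real // ler_sqr ?nnegrE // ler_norml; lra.
  by rewrite -real_normK ?num_real // ler_sqr ?nnegrE // ler_norml; lra.
rewrite AE int_segment_image; split; first exact/finite_image/finite_II.
rewrite -int_segment_image cnt_int_segment.
have -> : n%:R = (Num.floor y + 1 - Num.ceil x)%:~R :> R by rewrite -nE.
have := floor_itv y; have := ceil_itv x.
have -> : 2 * w / a = y - x by rewrite /y /x -mulrBl; congr (_ / _); ring.
rewrite !rmorphB !rmorphD /= ler_norml; lra.
Qed.

Lemma sum_distn (V : nmodType) (F : nat -> V) (n : nat) :
  \sum_(0 <= k < n.*2.+1) F `|k%:Z - n%:Z|%N =
  F 0%N + (\sum_(0 <= j < n) F j.+1) *+ 2.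
Proof.
elim: n => [|n IH]; first by rewrite double0 big_nat1 big_geq // mul0rn [RHS]addr0.
rewrite doubleS big_nat_recl // big_nat_recr //=.
have -> : \sum_(0 <= k < n.*2.+1) F `|k.+1%:Z - n.+1%:Z|%N =
          \sum_(0 <= k < n.*2.+1) F `|k%:Z - n%:Z|%N.
  by apply: eq_bigr => k _; congr F; lia.
have -> : `|n.*2.+2%:Z - n.+1%:Z|%N = n.+1 by lia.
rewrite subn0 IH [in RHS]big_nat_recr //= mulrnDl mulr2n [in RHS]mulr2n.
by rewrite addrC -!addrA.
Qed.

(** * Integer points in an ellipse *)

(** The quadratic form is triangular, so that the points with a fixed second
    coordinate form an interval. *)
Definition ellipse (R : realType) (a b h r : R) : set (int * int) :=
  [set z | (z.1%:~R * a + z.2%:~R * b) ^+ 2 + (z.2%:~R * h) ^+ 2 <= r ^+ 2].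

Lemma sqrt_sub_chord (R : realType) (r h : R) (n : int) : 0 < r ->
  Num.sqrt (r ^+ 2 - (n%:~R * h) ^+ 2) = r * chord (`|n|%N%:R * (h / r)).
Proof.
move=> r0; have rE : r = Num.sqrt (r ^+ 2) by rewrite sqrtr_sqr gtr0_norm.
rewrite [X in X * chord _]rE /chord -sqrtrM ?sqr_ge0 //; congr Num.sqrt.
have -> : (`|n|%N%:R * (h / r)) ^+ 2 = (n%:~R * (h / r)) ^+ 2 :> R.
  by rewrite !exprMn natr_absz intr_norm real_normK // num_real.
by field; rewrite gt_eqF.
Qed.

Lemma ellipse_row (R : realType) (a b h r : R) (J k : nat) :
  r <= J%:R * h -> 0 < h -> 0 <= r ->
  ellipse a b h r `&` [set z | `|(z.2 + J%:Z)%R|%N = k] =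
  (fun m : int => (m, k%:Z - J%:Z)) @`
    [set m : int | (m%:~R * a + (k%:Z - J%:Z)%:~R * b) ^+ 2 <=
                   r ^+ 2 - ((k%:Z - J%:Z)%:~R * h) ^+ 2].
Proof.
move=> rJ h0 r0; apply/seteqP; split; last first.
  by move=> _ [m /= mk <-]; split => /=; [rewrite /ellipse /= -lerBrDr | lia].
move=> [m n] [/= A kE].
suff nE : k%:Z - J%:Z = n.
  by exists m; rewrite /= nE //; move: A; rewrite /ellipse /= -lerBrDr.
have : (n%:~R * h) ^+ 2 <= (J%:R * h) ^+ 2.
  have := sqr_ge0 (m%:~R * a + n%:~R * b); move: A; rewrite /ellipse /=.
  nra.
rewrite -[leLHS]real_normK ?num_real // ler_sqr ?nnegrE ?mulr_ge0 ?(ltW h0) //.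
rewrite normrM (gtr0_norm h0) ler_pM2r // -intr_norm -[J%:R]/(J%:Z%:~R) ler_int.
lia.
Qed.

(** Gauss's count, row by row: a row of the ellipse holds as many points as
    its length divided by the spacing, up to one. *)
Lemma ellipse_count (R : realType) (a b h r : R) : 0 < a -> 0 < h -> 0 < r ->
  finite_set (ellipse a b h r) /\
  `|(cnt (ellipse a b h r))%:R - pi * r ^+ 2 / (a * h)|
    <= 2 * r / a + 2 * r / h + 3.
Proof.
move=> a0 h0 r0; pose J := (Num.truncn (r / h)).+1.
have rJ : r < J%:R * h by rewrite -ltr_pdivrMr // truncnS_gt.
have Jr : J%:R <= r / h + 1.
  by rewrite -natr1 lerD2r truncn_le // ltW // divr_gt0.
pose f (z : int * int) := `|(z.2 + J%:Z)%R|%N.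
have row k := ellipse_row a b k (ltW rJ) h0 (ltW r0).
have line k := cnt_line ((k%:Z - J%:Z)%:~R * b)
  (r ^+ 2 - ((k%:Z - J%:Z)%:~R * h) ^+ 2) a0.
have fK z : ellipse a b h r z -> (f z < J.*2.+1)%N.
  case: z => m n; rewrite /ellipse /f /= => A.
  have : (n%:~R * h) ^+ 2 <= (J%:R * h) ^+ 2.
    by have := sqr_ge0 (m%:~R * a + n%:~R * b); nra.
  rewrite -[leLHS]real_normK ?num_real // ler_sqr ?nnegrE ?mulr_ge0 ?(ltW h0) //.
  rewrite normrM (gtr0_norm h0) ler_pM2r // -intr_norm -[J%:R]/(J%:Z%:~R) ler_int.
  lia.
have fin : finite_set (ellipse a b h r).
  apply: (@sub_finite_set _ _ (\bigcup_(k in `I_J.*2.+1)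
      (ellipse a b h r `&` [set z | f z = k]))).
    by move=> z Az; exists (f z); [exact: fK | split].
  apply: bigcup_finite; first exact: finite_II.
  by move=> k _; rewrite row; apply: finite_image; case: (line k).
split=> //.
pose w (k : nat) := Num.sqrt (r ^+ 2 - ((k%:Z - J%:Z)%:~R * h) ^+ 2).
have cntE : `|(cnt (ellipse a b h r))%:R - \sum_(0 <= k < J.*2.+1) (2 * w k / a)|
    <= J.*2.+1%:R.
  rewrite (cnt_fibers fin fK) natr_sum -sumrB.
  apply: (le_trans (ler_norm_sum _ _ _)).
  rewrite -[leRHS](_ : \sum_(0 <= k < J.*2.+1) 1 = _); last first.
    by rewrite sumr_const_nat subn0.
  apply: ler_sum => k _; case: (line k) => fl.
  by rewrite row cnt_image // => x y _ _ [].
have t0 : 0 < h / r by rewrite divr_gt0.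
have Jt : 1 <= J%:R * (h / r).
  by rewrite mulrA ler_pdivlMr // mul1r ltW.
(* with step h/r, the half-lengths of the rows are r times the chords *)
have := chord_sum t0 Jt.
set S := \sum_(0 <= j < J) _ => /andP[S1 S2].
have sumw : \sum_(0 <= k < J.*2.+1) (2 * w k / a) = 2 / a * r * (1 + S *+ 2).
  have -> : S = \sum_(0 <= j < J) chord (j.+1%:R * (h / r)) by [].
  rewrite -[X in X + _](_ : chord (0%N%:R * (h / r)) = 1); last first.
    by rewrite mul0r /chord expr0n subr0 sqrtr1.
  rewrite -(sum_distn (fun j => chord (j%:R * (h / r)))) mulr_sumr.
  apply: eq_bigr => k _; rewrite /w sqrt_sub_chord //; ring.
rewrite sumw in cntE.
have c0 : 0 <= 4 * r ^+ 2 / (a * h).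
  by rewrite divr_ge0 ?mulr_ge0 ?sqr_ge0 // ltW.
have {}sumw : 2 / a * r * (1 + S *+ 2) =
    2 * r / a + 4 * r ^+ 2 / (a * h) * (h / r * S).
  by rewrite -mulr_natl; field; rewrite !gt_eqF.
have lo := ler_wpM2l c0 S1; have up := ler_wpM2l c0 S2.
have loE : 4 * r ^+ 2 / (a * h) * (pi / 4 - h / r) =
    pi * r ^+ 2 / (a * h) - 4 * (r / a).
  by move: (pi : R) => p; field; rewrite !gt_eqF.
have upE : 4 * r ^+ 2 / (a * h) * (pi / 4) = pi * r ^+ 2 / (a * h).
  by move: (pi : R) => p; field; rewrite !gt_eqF.
have J2 : J.*2.+1%:R <= 2 * r / h + 3.
  by rewrite -natr1 -addnn natrD; lra.
rewrite loE in lo; rewrite upE in up; rewrite sumw in cntE.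
move: cntE; rewrite !ler_norml; lra.
Qed.

(** * Coordinates with respect to a pair of vectors *)

Definition comb (R : realType) (u v : 'rV[R]_2) (z : int * int) : 'rV[R]_2 :=
  u *~ z.1 + v *~ z.2.

Definition dot (R : realType) (u v : 'rV[R]_2) : R :=
  u 0 0 * v 0 0 + u 0 1 * v 0 1.

Lemma enorm_ge0 (R : realType) (x : 'rV[R]_2) : 0 <= enorm x.
Proof. exact: sqrtr_ge0. Qed.

Lemma enorm_sqr (R : realType) (x : 'rV[R]_2) : enorm x ^+ 2 = dot x x.
Proof.
rewrite /enorm sqr_sqrtr; last by apply: sumr_ge0 => i _; apply: sqr_ge0.
rewrite !big_ord_recl big_ord0 addr0 /dot -!expr2; congr (x _ _ ^+ 2 + x _ _ ^+ 2).
exact: val_inj.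
Qed.

Lemma det_mx22 (R : comNzRingType) (A : 'M[R]_2) :
  \det A = A 0 0 * A 1 1 - A 0 1 * A 1 0.
Proof.
rewrite (expand_det_row _ 0) !big_ord_recl big_ord0 addr0 /cofactor.
rewrite !det_mx11 !mxE.
rewrite (_ : lift 0 0 = 1); last exact: val_inj.
rewrite (_ : lift 1 0 = 0); last exact: val_inj.
rewrite /= !add0n expr0 expr1 (_ : ord0 = 0); last exact: val_inj.
ring.
Qed.

Lemma areaE (R : realType) (u v : 'rV[R]_2) :
  area u v = `|u 0 0 * v 0 1 - u 0 1 * v 0 0|.
Proof.
have c0 j : (col_mx u v : 'M[R]_2) 0 j = u 0 j.
  by rewrite -[RHS](col_mxEu u v); congr (col_mx _ _ _ _); exact: val_inj.
have c1 j : (col_mx u v : 'M[R]_2) 1 j = v 0 j.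
  by rewrite -[RHS](col_mxEd u v); congr (col_mx _ _ _ _); exact: val_inj.
by rewrite /area det_mx22 !c0 !c1.
Qed.

Lemma combE (R : realType) (u v : 'rV[R]_2) (z : int * int) (i : 'I_2) :
  comb u v z 0 i = z.1%:~R * u 0 i + z.2%:~R * v 0 i.
Proof. by rewrite /comb -(scaler_int _ u) -(scaler_int _ v) !mxE. Qed.

Lemma rV2P (R : realType) (x y : 'rV[R]_2) :
  x 0 0 = y 0 0 -> x 0 1 = y 0 1 -> x = y.
Proof.
move=> e0 e1; apply/rowP => i; case: (i =P 0) => [-> //|i0].
suff -> : i = 1 by [].
by apply: val_inj; case: i i0 => [[|[|n]]] //= ? H; case: H; exact: val_inj.
Qed.

Lemma area_sqr (R : realType) (u v : 'rV[R]_2) :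
  area u v ^+ 2 = enorm u ^+ 2 * enorm v ^+ 2 - dot u v ^+ 2.
Proof.
by rewrite areaE real_normK ?num_real // !enorm_sqr /dot; ring.
Qed.

Lemma area_gt0 (R : realType) (u v : 'rV[R]_2) : area u v != 0 -> 0 < area u v.
Proof. by rewrite lt_def => -> /=; rewrite areaE. Qed.

Lemma area_enorm_gt0 (R : realType) (u v : 'rV[R]_2) :
  area u v != 0 -> 0 < enorm u.
Proof.
move=> uv; rewrite lt_def enorm_ge0 andbT; apply: contraNneq uv => u0.
rewrite -sqrf_eq0 area_sqr u0 expr0n mul0r sub0r oppr_eq0.
have /eqP := enorm_sqr u; rewrite u0 expr0n eq_sym /dot -!expr2.
rewrite paddr_eq0 ?sqr_ge0 // !sqrf_eq0 => /andP[/eqP e0 /eqP e1].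
by rewrite /dot e0 e1 !mul0r addr0.
Qed.

(** Lagrange's identity: in coordinates along and across the first vector, the
    Euclidean norm of a lattice vector is a triangular quadratic form. *)
Lemma comb_ellipse (R : realType) (u v : 'rV[R]_2) (r : R) :
  area u v != 0 -> 0 <= r ->
  ellipse (enorm u) (dot u v / enorm u) (area u v / enorm u) r =
  [set z | enorm (comb u v z) <= r].
Proof.
move=> uv r0; have u0 := area_enorm_gt0 uv; apply: funext => z; apply: propext.
rewrite /ellipse /= -[enorm _ <= r]ler_sqr ?nnegrE ?enorm_ge0 //.
suff -> : enorm (comb u v z) ^+ 2 =
  (z.1%:~R * enorm u + z.2%:~R * (dot u v / enorm u)) ^+ 2 +
  (z.2%:~R * (area u v / enorm u)) ^+ 2 by [].
set m : R := z.1%:~R; set n : R := z.2%:~R.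
transitivity (m ^+ 2 * enorm u ^+ 2 + 2 * m * n * dot u v +
  n ^+ 2 * ((dot u v ^+ 2 + area u v ^+ 2) / enorm u ^+ 2)); last first.
  by field; rewrite gt_eqF.
rewrite area_sqr subrKC [_ * enorm v ^+ 2 / _]mulrAC divff ?mul1r;
  last by rewrite expf_neq0 // gt_eqF.
by rewrite !enorm_sqr /dot !combE -/m -/n; ring.
Qed.

Lemma coordinates (R : realType) (u v x : 'rV[R]_2) : area u v != 0 ->
  exists s t : R, x = s *: u + t *: v.
Proof.
move=> uv; pose D := u 0 0 * v 0 1 - u 0 1 * v 0 0.
have D0 : D != 0 by rewrite -normr_eq0 -areaE.
exists ((x 0 0 * v 0 1 - x 0 1 * v 0 0) / D), ((u 0 0 * x 0 1 - u 0 1 * x 0 0) / D).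
by apply: rV2P; rewrite !mxE; move: D0; rewrite /D => D0; field.
Qed.

Lemma coordinates_uniq (R : realType) (u v : 'rV[R]_2) (s t s' t' : R) :
  area u v != 0 -> s *: u + t *: v = s' *: u + t' *: v -> s = s' /\ t = t'.
Proof.
move=> uv /rowP E; have := E 0; have := E 1; rewrite !mxE => E1 E0.
have D0 : u 0 0 * v 0 1 - u 0 1 * v 0 0 != 0 by rewrite -normr_eq0 -areaE.
have Es : (s - s') * (u 0 0 * v 0 1 - u 0 1 * v 0 0) = 0.
  rewrite [LHS](_ : _ =
    (s * u 0 0 + t * v 0 0 - (s' * u 0 0 + t' * v 0 0)) * v 0 1 -
    (s * u 0 1 + t * v 0 1 - (s' * u 0 1 + t' * v 0 1)) * v 0 0); last by ring.
  by rewrite E0 E1 !subrr !mul0r subrr.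
have Et : (t - t') * (u 0 0 * v 0 1 - u 0 1 * v 0 0) = 0.
  rewrite [LHS](_ : _ =
    (s * u 0 1 + t * v 0 1 - (s' * u 0 1 + t' * v 0 1)) * u 0 0 -
    (s * u 0 0 + t * v 0 0 - (s' * u 0 0 + t' * v 0 0)) * u 0 1); last by ring.
  by rewrite E0 E1 !subrr !mul0r subrr.
move/eqP: Es; move/eqP: Et; rewrite !mulf_eq0 (negbTE D0) !orbF !subr_eq0.
by move=> /eqP -> /eqP ->.
Qed.

Lemma comb_lin (R : realType) (u v : 'rV[R]_2) (z : int * int) :
  comb u v z = z.1%:~R *: u + z.2%:~R *: v.
Proof. by rewrite !scaler_int. Qed.

Lemma comb_inj (R : realType) (u v : 'rV[R]_2) :
  area u v != 0 -> injective (comb u v).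
Proof.
move=> uv [m n] [m' n']; rewrite !comb_lin => /(coordinates_uniq uv) /= [].
by move=> /intr_inj -> /intr_inj ->.
Qed.

(** * Grids and reduced bases *)

Definition grid (R : realType) (u v : 'rV[R]_2) : set 'rV[R]_2 :=
  range (comb u v).

Lemma gridC (R : realType) (u v : 'rV[R]_2) : grid v u = grid u v.
Proof.
suff H (a b : 'rV[R]_2) : grid a b `<=` grid b a by apply/seteqP; split; apply: H.
by move=> _ [z _ <-]; exists (z.2, z.1) => //; rewrite /comb addrC.
Qed.

Lemma grid_shear (R : realType) (u v : 'rV[R]_2) (e : int) :
  grid u (v + u *~ e) = grid u v.
Proof.
have H w (k : int) : grid u (w + u *~ k) `<=` grid u w.
  move=> _ [z _ <-]; exists (z.1 + k * z.2, z.2) => //.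
  rewrite /comb /= mulrzDr mulrzDl -mulrzA -addrA; congr (_ + _).
  by rewrite addrC.
apply/seteqP; split; first exact: H.
by have := H (v + u *~ e) (- e); rewrite mulrNz addrK.
Qed.

Lemma areaC (R : realType) (u v : 'rV[R]_2) : area v u = area u v.
Proof. by rewrite !areaE -normrN; congr `|_|; ring. Qed.

Lemma area_shear (R : realType) (u v : 'rV[R]_2) (e : int) :
  area u (v + u *~ e) = area u v.
Proof. by rewrite !areaE -scaler_int !mxE; congr `|_|; ring. Qed.

Lemma grid_l (R : realType) (u v : 'rV[R]_2) : grid u v u.
Proof. by exists (1, 0) => //; rewrite /comb mulr1z mulr0z addr0. Qed.

Lemma enorm0 (R : realType) : enorm (0 : 'rV[R]_2) = 0.
Proof.
by apply/eqP; rewrite -sqrf_eq0 enorm_sqr /dot !mxE mulr0 addr0.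
Qed.

(** The origin is at distance at least 1 from the other points; for an additive
    group this bounds all mutual distances. *)
Definition unit_separated (R : realType) (L : set 'rV[R]_2) : Prop :=
  forall x, L x -> x != 0 -> 1 <= enorm x.

(** Lagrange reduction. Subtracting from the longer vector a multiple of the
    shorter one shrinks the sum of the squared norms by at least 1/2 as long as
    the basis is not nearly reduced, so the process stops. *)
Lemma reduced_basis_rec (R : realType) (n : nat) (u v : 'rV[R]_2) :
  unit_separated (grid u v) -> area u v != 0 ->
  enorm u ^+ 2 + enorm v ^+ 2 <= n%:R / 2 ->
  exists u' v', [/\ grid u' v' = grid u v, area u' v' = area u v,
    1 <= enorm u' & enorm u' <= 2 * area u' v'].
Proof.
elim: n u v => [|n IH] u v sep uv un.
  have := area_enorm_gt0 uv; have := enorm_ge0 v; nra.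
wlog uLv : u v sep uv un / enorm u <= enorm v.
  move=> H; have [|/ltW] := leP (enorm u) (enorm v); first exact: H.
  by move=> vu; have := H v u; rewrite gridC areaC addrC; apply.
have u0 := area_enorm_gt0 uv.
have u1 : 1 <= enorm u.
  apply: sep; first exact: grid_l.
  by apply: contraTneq u0 => ->; rewrite enorm0 ltxx.
have [small|large] := leP (2 * `|dot u v|) (enorm u ^+ 2 + 2^-1).
  exists u, v; split=> //.
  have A0 := area_gt0 uv.
  rewrite -ler_sqr ?nnegrE ?mulr_ge0 ?(ltW A0) ?enorm_ge0 // exprMn area_sqr.
  have -> : dot u v ^+ 2 = `|dot u v| ^+ 2 by rewrite real_normK ?num_real.
  have := normr_ge0 (dot u v); move: (`|dot u v|) small => c small c0.
  have uv2 : enorm u ^+ 2 <= enorm v ^+ 2 by rewrite ler_sqr ?nnegrE ?enorm_ge0.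
  have u2 : 1 <= enorm u ^+ 2 by rewrite exprn_ege1.
  move: (enorm u ^+ 2) (enorm v ^+ 2) uv2 u2 small => U V UV U1 small.
  have c34 : c <= 3 / 4 * U by lra.
  have cc : c ^+ 2 <= (3 / 4 * U) ^+ 2 by rewrite ler_sqr ?nnegrE //; lra.
  nra.
(* the sign that makes v + e u shorter than v *)
pose e : int := if 0 <= dot u v then -1 else 1.
have eE : e%:~R * dot u v = - `|dot u v|.
  rewrite /e; have [d0|d0] := leP 0 (dot u v).
    by rewrite ger0_norm // rmorphN1 mulN1r.
  by rewrite ltr0_norm // opprK mul1r.
have e2 : e%:~R ^+ 2 = 1 :> R.
  by rewrite /e; case: ifP => _; rewrite ?sqrrN expr1n.
have := IH u (v + u *~ e); rewrite grid_shear area_shear; apply=> //.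
have -> : enorm (v + u *~ e) ^+ 2 = enorm v ^+ 2 + 2 * (e%:~R * dot u v) +
    e%:~R ^+ 2 * enorm u ^+ 2.
  by rewrite !enorm_sqr /dot -scaler_int !mxE; ring.
rewrite eE e2; move: un; rewrite -natr1; lra.
Qed.

Lemma reduced_basis (R : realType) (u v : 'rV[R]_2) :
  unit_separated (grid u v) -> area u v != 0 ->
  exists u' v', [/\ grid u' v' = grid u v, area u' v' = area u v,
    1 <= enorm u' & enorm u' <= 2 * area u' v'].
Proof.
move=> sep uv; pose x := 2 * (enorm u ^+ 2 + enorm v ^+ 2).
apply: (@reduced_basis_rec _ (Num.truncn x).+1) => //.
rewrite ler_pdivlMr // mulrC ltW //; exact: truncnS_gt.
Qed.

Lemma comb_disc_finite (R : realType) (u v : 'rV[R]_2) (r : R) :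
  area u v != 0 -> 0 < r -> finite_set [set z | enorm (comb u v z) <= r].
Proof.
move=> uv r0; have u0 := area_enorm_gt0 uv.
rewrite -(comb_ellipse uv (ltW r0)).
by have [] := ellipse_count (dot u v / enorm u) u0 (divr_gt0 (area_gt0 uv) u0) r0.
Qed.

Lemma grid_disc_image (R : realType) (u v : 'rV[R]_2) (r : R) :
  grid u v `&` disc r = comb u v @` [set z | enorm (comb u v z) <= r].
Proof.
apply/seteqP; split; first by move=> _ [[z _ <-] /= zr]; exists z.
by move=> _ [z /= zr <-]; split => //; exists z.
Qed.

Lemma grid_disc_count (R : realType) (u v : 'rV[R]_2) (r : R) :
  area u v != 0 -> 0 < r ->
  finite_set (grid u v `&` disc r) /\
  `|(cnt (grid u v `&` disc r))%:R - pi * r ^+ 2 / area u v|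
    <= 2 * r / enorm u + 2 * r / (area u v / enorm u) + 3.
Proof.
move=> uv r0; have u0 := area_enorm_gt0 uv; have A0 := area_gt0 uv.
have := @ellipse_count R (enorm u) (dot u v / enorm u) (area u v / enorm u) r u0.
rewrite divr_gt0 // => /(_ isT r0); rewrite (comb_ellipse uv (ltW r0)) => -[fin C].
rewrite grid_disc_image; split; first exact: finite_image.
rewrite cnt_image //; last by move=> x y _ _; apply: comb_inj.
by move: C; rewrite [enorm u * _]mulrCA divff ?gt_eqF // mulr1.
Qed.

(** A nearly reduced basis turns the error of [grid_disc_count] into one that
    depends on the radius alone, uniformly over the lattices. *)
Lemma separated_disc_count (R : realType) (u v : 'rV[R]_2) (r : R) :
  unit_separated (grid u v) -> area u v != 0 -> 0 < r ->
  finite_set (grid u v `&` disc r) /\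
  `|(cnt (grid u v `&` disc r))%:R - pi * r ^+ 2 / area u v| <= 6 * r + 3.
Proof.
move=> sep uv r0; have [u' [v' [<- AE u1 u2]]] := reduced_basis sep uv.
rewrite -AE; rewrite -AE in uv; have [fin C] := grid_disc_count uv r0.
split=> //; apply: (le_trans C); rewrite lerD2r.
have u0 : 0 < enorm u' by lra.
have H1 : 2 * r / enorm u' <= 2 * r by rewrite ler_pdivrMr //; nra.
have H2 : 2 * r / (area u' v' / enorm u') <= 4 * r.
  by rewrite ler_pdivrMr ?divr_gt0 ?area_gt0 // mulrA ler_pdivlMr //; nra.
lra.
Qed.

Lemma separated_area_ge (R : realType) (u v : 'rV[R]_2) :
  unit_separated (grid u v) -> area u v != 0 -> 2^-1 <= area u v.
Proof.
move=> sep uv; have [u' [v' [_ <- u1 u2]]] := reduced_basis sep uv; lra.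
Qed.

(** * Primitive vertices *)

Definition zgcd (z : int * int) : nat := gcdn `|z.1| `|z.2|.

Definition zscale (k : nat) (z : int * int) : int * int :=
  (k%:Z * z.1, k%:Z * z.2).

Lemma zgcd_scale (k : nat) (z : int * int) : zgcd (zscale k z) = (k * zgcd z)%N.
Proof. by rewrite /zgcd /= !abszM /= muln_gcdr. Qed.

Lemma zscale_zgcd (z : int * int) : exists z', z = zscale (zgcd z) z'.
Proof.
case: z => m n.
have /dvdzP[p pE] : (zgcd (m, n) %| m)%Z by rewrite dvdzE dvdn_gcdl.
have /dvdzP[q qE] : (zgcd (m, n) %| n)%Z by rewrite dvdzE dvdn_gcdr.
by exists (p, q); rewrite /zscale /= ![_%:Z * _]mulrC -pE -qE.
Qed.

Lemma zscale_inj (k : nat) : (0 < k)%N -> injective (zscale k).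
Proof.
move=> k0 [m n] [m' n'] [].
have kn : k%:Z != 0 by rewrite eqz_nat -lt0n.
by move=> /(mulfI kn) -> /(mulfI kn) ->.
Qed.

Lemma comb_scale (R : realType) (u v : 'rV[R]_2) (k : nat) (z : int * int) :
  comb u v (zscale k z) = comb u v z *+ k.
Proof.
by rewrite /comb /= mulrnDl ![k%:Z * _]mulrC !mulrzA.
Qed.

Lemma enorm_mulrn (R : realType) (x : 'rV[R]_2) (k : nat) :
  enorm (x *+ k) = k%:R * enorm x.
Proof.
apply/eqP; rewrite -(@eqrXn2 _ 2) ?enorm_ge0 ?mulr_ge0 ?enorm_ge0 //.
by apply/eqP; rewrite exprMn !enorm_sqr /dot -scaler_nat !mxE; ring.
Qed.

Lemma comb0 (R : realType) (u v : 'rV[R]_2) : comb u v (0, 0) = 0.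
Proof. by rewrite /comb !mulr0z addr0. Qed.

Lemma zgcd_eq0 (z : int * int) : zgcd z = 0%N -> z = (0, 0).
Proof.
case: z => m n /eqP; rewrite /zgcd /= eqn0Ngt gcdn_gt0 negb_or -!eqn0Ngt.
by rewrite !absz_eq0 => /andP[/eqP -> /eqP ->].
Qed.

(** In coordinates, primitivity is coprimality: dividing by the gcd of the
    coordinates exhibits a vertex as a multiple of another one. *)
Lemma primitive_grid (R : realType) (u v : 'rV[R]_2) : area u v != 0 ->
  primitive (grid u v) = comb u v @` [set z | zgcd z = 1%N].
Proof.
move=> uv; apply/seteqP; split=> [_ [[z _ <-]] x0 prim|_ [z /= z1 <-]].
  exists z => //=; have [z' zE] := zscale_zgcd z.
  case: (posnP (zgcd z)) => [/zgcd_eq0 z0|g0].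
    by move: x0; rewrite z0 comb0 eqxx.
  have gE : zgcd z = (zgcd z * zgcd z')%N by rewrite {1}zE zgcd_scale.
  have z'1 : zgcd z' = 1%N.
    by apply/eqP; rewrite -(eqn_pmul2l g0) -gE muln1.
  have [zz|zz] := eqVneq z' z; first by rewrite -zz.
  have := prim (comb u v z') (zgcd z).
  rewrite -comb_scale -zE eqxx (inj_eq (comb_inj uv)) => H.
  by have := H (ex_intro2 _ _ z' I erefl) zz g0.
split; first by exists z.
- by apply/eqP; rewrite -(comb0 u v) => /(comb_inj uv) zE; rewrite zE in z1.
- move=> _ k [z' _ <-] z'z k0; apply/eqP; rewrite -comb_scale => /(comb_inj uv) zE.
  have : (k * zgcd z' = 1)%N by rewrite -zgcd_scale -zE.
  move/eqP; rewrite muln_eq1 => /andP[/eqP k1 _]; move: z'z.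
  by rewrite zE k1 /zscale !mul1r -surjective_pairing eqxx.
Qed.

Lemma num_primitive_grid (R : realType) (u v : 'rV[R]_2) (r : R) :
  area u v != 0 -> 0 < r ->
  num_primitive (grid u v) r =
  cnt [set z | zgcd z = 1%N /\ enorm (comb u v z) <= r].
Proof.
move=> uv r0.
have fin := comb_disc_finite uv r0.
rewrite -[RHS](@cnt_image _ _ (comb u v)); last 2 first.
- by apply: sub_finite_set fin => z [].
- by move=> x y _ _; apply: comb_inj.
congr cnt; rewrite primitive_grid //; apply/seteqP; split.
  by move=> _ [[z /= z1 <-] zr]; exists z.
by move=> _ [z [z1 zr] <-]; split => //; exists z.
Qed.

(** The vertices are sorted by the gcd k of their coordinates. The class of
    k > 0 is k times the set of the primitive vertices in the disc of radius
    r/k, and it is empty for k > r since primitive vertices have norm at least 1;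
    the class of k = 0 is the origin, which accounts for the 1. *)
Lemma disc_count_primitive (R : realType) (u v : 'rV[R]_2) (r : R) :
  unit_separated (grid u v) -> area u v != 0 -> 1 <= r ->
  cnt (grid u v `&` disc r) =
  (1 + \sum_(0 <= k < Num.truncn r) num_primitive (grid u v) (r / k.+1%:R))%N.
Proof.
move=> sep uv r1; have r0 : 0 < r by lra.
have fin := comb_disc_finite uv r0.
rewrite grid_disc_image cnt_image //; last by move=> x y _ _; apply: comb_inj.
rewrite (@cnt_fibers _ _ zgcd (Num.truncn r).+1) // => [|z /= zr]; last first.
  case: (posnP (zgcd z)) => [-> //|g0]; have [z' zE] := zscale_zgcd z.
  rewrite ltnS (truncn_ge_nat _ (ltW r0)); apply: le_trans zr.
  rewrite {2}zE comb_scale enorm_mulrn ler_peMr //; apply: sep; first by exists z'.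
  apply: contraTneq g0 => z0; rewrite -eqn0Ngt {1}zE zgcd_scale.
  suff -> : z' = (0, 0) by rewrite muln0.
  by apply: (comb_inj uv); rewrite z0 comb0.
rewrite big_nat_recl //; congr (_ + _)%N.
  rewrite -[RHS](_ : cnt [set ((0 : int), (0 : int))] = _); last first.
    by rewrite /cnt fset_set1 cardfs1.
  congr cnt; apply/seteqP; split=> [z [_ /zgcd_eq0 -> //]|_ ->].
  by split; rewrite /= ?comb0 ?enorm0 ?ltW.
rewrite !big_nat; apply: eq_bigr => k _.
rewrite num_primitive_grid ?divr_gt0 // -[RHS](@cnt_image _ _ (zscale k.+1)).
- congr cnt; apply/seteqP; split=> [z [/= zr zk]|_ [z [/= z1 zr] <-]].
    have [z' zE] := zscale_zgcd z; rewrite zk in zE; exists z' => //=; split.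
      apply/eqP; rewrite -(eqn_pmul2l (ltn0Sn k)) muln1 -[X in _ == X]zk zE.
      by rewrite zgcd_scale.
    by rewrite ler_pdivlMr // mulrC -enorm_mulrn -comb_scale -zE.
  split=> /=; last by rewrite zgcd_scale z1 muln1.
  by rewrite comb_scale enorm_mulrn mulrC -ler_pdivlMr.
- apply: sub_finite_set fin => z [_ zr] /=; apply: (le_trans zr).
  by rewrite ler_pdivrMr // ler_peMr ?ler1n // ltW.
- by move=> x y _ _; apply: zscale_inj.
Qed.

(** * The asymptotic count of primitive vertices *)

(** The deviation from the expected count of primitive vertices, the expected
    count of all vertices divided by zeta(2). *)
Definition primitive_error (R : realType) (u v : 'rV[R]_2) (r : R) : R :=
  (num_primitive (grid u v) r)%:R - pi * r ^+ 2 / (area u v * zeta2 R).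

Lemma density_bounds (R : realType) (u v : 'rV[R]_2) :
  unit_separated (grid u v) -> area u v != 0 ->
  0 <= pi / (area u v * zeta2 R) <= 8 /\ pi / area u v <= 8.
Proof.
move=> sep uv; have A0 := area_gt0 uv; have := separated_area_ge sep uv.
have Z1 := zeta2_ge1 R; have p0 := @pi_gt0 R; have p4 := @pihalf_lt2 R.
move=> A2; have Z0 : 0 < zeta2 R by lra.
have AZ : 0 < area u v * zeta2 R by rewrite mulr_gt0.
rewrite (divr_ge0 (ltW p0) (ltW AZ)) /= !ler_pdivrMr //.
by split; nra.
Qed.

(** Summing the expected counts at r/k over k gives the expected count of all
    vertices, up to the tail of zeta(2), which is at most 1/r up to a constant;
    the true counts add up to that of all vertices. *)
Lemma primitive_error_sum (R : realType) (u v : 'rV[R]_2) (r : R) :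
  unit_separated (grid u v) -> area u v != 0 -> 1 <= r ->
  `|\sum_(0 <= k < Num.truncn r) primitive_error u v (r / k.+1%:R)| <= 26 * r.
Proof.
move=> sep uv r1; have r0 : 0 < r by lra.
have [/andP[c0 c8] _] := density_bounds sep uv.
have [_] := separated_disc_count sep uv r0.
rewrite disc_count_primitive // natrD natr_sum.
set K := Num.truncn r; set c := pi / _ in c0 c8 *.
have K1 : (0 < K)%N by rewrite truncn_gt0.
have Z0 : 0 < zeta2 R by have := zeta2_ge1 R; lra.
have -> : pi * r ^+ 2 / area u v = c * r ^+ 2 * zeta2 R.
  rewrite /c; move: (pi : R) => p; field; by rewrite uv gt_eqF.
have -> : \sum_(0 <= k < K) primitive_error u v (r / k.+1%:R) =
    \sum_(0 <= k < K) (num_primitive (grid u v) (r / k.+1%:R))%:R -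
    c * r ^+ 2 * sqr_sum R K.
  rewrite /sqr_sum mulr_sumr -sumrB; apply: eq_bigr => k _.
  rewrite /primitive_error -/c; congr (_ - _); rewrite /c.
  by rewrite expr_div_n; ring.
set P := \sum_(_ <= _ < _) _.
have Zlo := sqr_sum_le_zeta2 R K; have Zup := zeta2_le_sqr_sum R K1.
have rK : r ^+ 2 * (zeta2 R - sqr_sum R K) <= 2 * r.
  have H1 : r ^+ 2 * (zeta2 R - sqr_sum R K) <= r ^+ 2 * K%:R^-1.
    by rewrite ler_wpM2l ?sqr_ge0 //; lra.
  apply: (le_trans H1); rewrite ler_pdivrMr ?ltr0n // expr2 mulrAC ler_pM2r //.
  have : r < K.+1%:R by exact: truncnS_gt.
  have : 1 <= K%:R :> R by rewrite ler1n.
  by rewrite -natr1; lra.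
have rZ : 0 <= r ^+ 2 * (zeta2 R - sqr_sum R K).
  by rewrite mulr_ge0 ?sqr_ge0 // subr_ge0.
have cr : 0 <= c * (r ^+ 2 * (zeta2 R - sqr_sum R K)) <= 16 * r.
  by rewrite mulr_ge0 //=; nra.
rewrite !ler_norml; lra.
Qed.

(** The starting point of the iteration: primitive vertices are vertices. *)
Lemma primitive_error_apriori (R : realType) (u v : 'rV[R]_2) (r : R) :
  unit_separated (grid u v) -> area u v != 0 -> 1 <= r ->
  `|primitive_error u v r| <= 17 * r ^+ 2.
Proof.
move=> sep uv r1; have r0 : 0 < r by lra.
have [/andP[c0 c8] d8] := density_bounds sep uv.
have [_] := separated_disc_count sep uv r0.
rewrite disc_count_primitive // natrD natr_sum.
have : (0 < Num.truncn r)%N by rewrite truncn_gt0.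
case: (Num.truncn r) => // K _; rewrite big_nat_recl // divr1 => H.
have S0 : 0 <= \sum_(0 <= k < K) (num_primitive (grid u v) (r / k.+2%:R))%:R :> R.
  by apply: sumr_ge0.
have P0 : 0 <= (num_primitive (grid u v) r)%:R :> R by [].
move: H; rewrite /primitive_error ![pi * _ / _]mulrAC.
have rr : r <= r ^+ 2 by rewrite expr2; nra.
move: (pi / area u v) (pi / (area u v * zeta2 R)) c0 c8 d8 => d c c0 c8 d8.
have cr : 0 <= c * r ^+ 2 <= 8 * r ^+ 2.
  by apply/andP; split; [rewrite mulr_ge0 ?sqr_ge0 | rewrite ler_wpM2r ?sqr_ge0].
have dr : d * r ^+ 2 <= 8 * r ^+ 2 by rewrite ler_wpM2r ?sqr_ge0.
rewrite !ler_norml; lra.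
Qed.

(** The heart of the sieve: the errors at r, r/2, r/3, ... cancel up to O(r),
    and the weights of the errors at r/2, r/3, ... add up to zeta(2) - 1 <= 3/4,
    so that an error bound E r^2 improves itself by a constant factor. *)
Lemma primitive_error_contract (R : realType) (u v : 'rV[R]_2) (E M : R) :
  unit_separated (grid u v) -> area u v != 0 -> 0 < E -> 0 <= M ->
  (forall r, 1 <= r -> `|primitive_error u v r| <= E * r ^+ 2 + M) ->
  forall r, 1 <= r ->
  `|primitive_error u v r| <= 7 / 8 * E * r ^+ 2 + 2 * (26 + M) ^+ 2 / E.
Proof.
move=> sep uv E0 M0 H r r1; have r0 : 0 < r by lra.
have := primitive_error_sum sep uv r1.
have : (0 < Num.truncn r)%N by rewrite truncn_gt0.
have := truncn_le r; rewrite (ltW r0).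
case: (Num.truncn r) => // K Kr _; rewrite big_nat_recl // divr1.
set e := primitive_error u v r; set S := \sum_(0 <= _ < _) _ => eS.
have SE : `|S| <= E * r ^+ 2 * (3 / 4) + M * r.
  have : `|S| <= \sum_(0 <= k < K) (E * r ^+ 2 * (k.+2%:R ^+ 2)^-1 + M).
    apply: (le_trans (ler_norm_sum _ _ _)); rewrite !big_nat.
    apply: ler_sum => k /andP[_ kK].
    have := H (r / k.+2%:R); rewrite expr_div_n mulrA; apply.
    rewrite ler_pdivlMr // mul1r; apply: le_trans Kr.
    by rewrite ler_nat.
  move/le_trans; apply; rewrite big_split /= -mulr_sumr sumr_const_nat subn0.
  apply: lerD.
    rewrite ler_wpM2l ?(mulr_ge0 (ltW E0) (sqr_ge0 r)) //.
    have := sqr_sum_le_zeta2 R K.+1; have := zeta2_le R.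
    rewrite /sqr_sum big_nat_recl // expr1n invr1; lra.
  rewrite -mulr_natr ler_wpM2l //; apply: le_trans Kr.
  by rewrite ler_nat.
have e1 : `|e| <= 26 * r + `|S|.
  have -> : e = (e + S) - S by rewrite addrK.
  by rewrite (le_trans (ler_normB _ _)) // lerD2r.
apply: (le_trans e1).
(* a linear term costs a small quadratic one and a constant *)
have amgm : (26 + M) * r <= E / 8 * r ^+ 2 + 2 * (26 + M) ^+ 2 / E.
  rewrite -subr_ge0.
  have -> : E / 8 * r ^+ 2 + 2 * (26 + M) ^+ 2 / E - (26 + M) * r =
    (E * r - 4 * (26 + M)) ^+ 2 / (8 * E) by field; rewrite gt_eqF.
  by rewrite divr_ge0 ?sqr_ge0 // mulr_ge0 // ltW.
lra.
Qed.

(** The constant M does not depend on the lattice; this makes it possible to pass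
    to the maximum over all lattices. *)
Lemma primitive_count (R : realType) (eps : R) : 0 < eps ->
  exists M, forall u v : 'rV[R]_2, unit_separated (grid u v) -> area u v != 0 ->
  forall r, 1 <= r -> `|primitive_error u v r| <= eps * r ^+ 2 + M.
Proof.
move=> eps0.
have iter n : exists2 M, 0 <= M & forall u v : 'rV[R]_2,
    unit_separated (grid u v) -> area u v != 0 ->
    forall r, 1 <= r -> `|primitive_error u v r| <= 17 * (7 / 8) ^+ n * r ^+ 2 + M.
  elim: n => [|n [M M0 H]].
    exists 0 => // u v sep uv r r1; rewrite expr0 mulr1 addr0.
    exact: primitive_error_apriori.
  have E0 : 0 < 17 * (7 / 8) ^+ n :> R by rewrite mulr_gt0 // exprn_gt0.
  exists (2 * (26 + M) ^+ 2 / (17 * (7 / 8) ^+ n)).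
    by rewrite divr_ge0 ?(ltW E0) // mulr_ge0 ?sqr_ge0.
  move=> u v sep uv r r1; rewrite exprS [17 * _]mulrCA.
  by apply: primitive_error_contract => //; apply: H.
have : (fun n => (7 / 8 : R) ^+ n) @ \oo --> (0 : R).
  by apply: cvg_expr; rewrite ger0_norm //; lra.
move/cvgrPdist_lt => /(_ (eps / 17)); rewrite divr_gt0 // => /(_ isT) [n _ /(_ n (leqnn n))].
rewrite /= sub0r normrN ger0_norm ?exprn_ge0 //.
rewrite ltr_pdivlMr // mulrC => small.
have [M _ H] := iter n; exists M => u v sep uv r r1.
apply: (le_trans (H u v sep uv r r1)); rewrite lerD2r ler_wpM2r ?sqr_ge0 //.
exact: ltW.
Qed.

(** * Parallelograms that are fundamental domains *)

Lemma combD (R : realType) (u v : 'rV[R]_2) (y z : int * int) :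
  comb u v (y.1 + z.1, y.2 + z.2) = comb u v y + comb u v z.
Proof. by rewrite /comb /= !mulrzDr addrACA. Qed.

Lemma combN (R : realType) (u v : 'rV[R]_2) (z : int * int) :
  comb u v (- z.1, - z.2) = - comb u v z.
Proof. by rewrite /comb /= !mulrNz opprD. Qed.

Lemma grid0 (R : realType) (u v : 'rV[R]_2) : grid u v 0.
Proof. by exists (0, 0) => //; apply: comb0. Qed.

Lemma gridD (R : realType) (u v x y : 'rV[R]_2) :
  grid u v x -> grid u v y -> grid u v (x + y).
Proof. by move=> [a _ <-] [b _ <-]; eexists; last exact: combD. Qed.

Lemma gridN (R : realType) (u v x : 'rV[R]_2) : grid u v x -> grid u v (- x).
Proof. by move=> [a _ <-]; eexists; last exact: combN. Qed.

Lemma translations_grid (R : realType) (u v : 'rV[R]_2) :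
  translations (grid u v) = grid u v.
Proof.
apply/seteqP; split=> [t /= <-|t gt /=].
  by exists 0; [exact: grid0 | rewrite add0r].
apply/seteqP; split=> [_ [x gx <-]|x gx]; first exact: gridD.
by exists (x - t); [apply: gridD => //; exact: gridN | rewrite subrK].
Qed.

(** The translate of the parallelogram that contains x is found by rounding down
    the coordinates of x. *)
Lemma parallelogram_floor (R : realType) (p u v x : 'rV[R]_2) (s t : R)
    (z : int * int) : area u v != 0 -> x - p = s *: u + t *: v ->
  parallelogram p u v (x - comb u v z) <->
  z = (Num.floor s, Num.floor t).
Proof.
move=> uv xp; have xE : x = p + (s *: u + t *: v) by rewrite -xp subrKC.
have xz : x - comb u v z = p + (s - z.1%:~R) *: u + (t - z.2%:~R) *: v.
  by rewrite xE comb_lin !scalerBl opprD -!addrA; congr (_ + (_ + _)); rewrite addrCA.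
split=> [[a [b [a01 b01]]]|->].
  rewrite xz -!addrA => /addrI /(coordinates_uniq uv)[sa tb].
  rewrite [z]surjective_pairing; congr (_, _); symmetry; apply: floor_def.
    by rewrite rmorphD /=; lra.
  by rewrite rmorphD /=; lra.
rewrite xE comb_lin /=.
exists (s - (Num.floor s)%:~R), (t - (Num.floor t)%:~R); split.
- by have := floor_itv s; rewrite rmorphD /=; lra.
- by have := floor_itv t; rewrite rmorphD /=; lra.
- by rewrite !scalerBl opprD -!addrA; congr (_ + (_ + _)); rewrite addrCA.
Qed.

Lemma fundamental_basis (R : realType) (p u v : 'rV[R]_2) : area u v != 0 ->
  fundamental_domain (grid u v) (parallelogram p u v).
Proof.
move=> uv x; have [s [t xp]] := coordinates (x - p) uv.
exists (comb u v (Num.floor s, Num.floor t)); split.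
  split; first by rewrite translations_grid; eexists.
  by apply/(parallelogram_floor _ uv xp).
move=> y []; rewrite translations_grid => -[z _ <-].
by move/(parallelogram_floor _ uv xp) => ->.
Qed.

Lemma enormD (R : realType) (x y : 'rV[R]_2) : enorm (x + y) <= enorm x + enorm y.
Proof.
rewrite -ler_sqr ?nnegrE ?addr_ge0 ?enorm_ge0 //.
have dxy : dot x y <= enorm x * enorm y.
  apply: le_trans (ler_norm _) _.
  rewrite -ler_sqr ?nnegrE ?mulr_ge0 ?enorm_ge0 // real_normK ?num_real //.
  by rewrite exprMn -subr_ge0 -area_sqr sqr_ge0.
have -> : enorm (x + y) ^+ 2 = enorm x ^+ 2 + 2 * dot x y + enorm y ^+ 2.
  by rewrite !enorm_sqr /dot !mxE; ring.
rewrite sqrrD; lra.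
Qed.

Lemma enormZ (R : realType) (x : 'rV[R]_2) (s : R) : 0 <= s ->
  enorm (s *: x) = s * enorm x.
Proof.
move=> s0; apply/eqP; rewrite -(@eqrXn2 _ 2) ?mulr_ge0 ?enorm_ge0 //.
by apply/eqP; rewrite exprMn !enorm_sqr /dot !mxE; ring.
Qed.

Lemma enormN (R : realType) (x : 'rV[R]_2) : enorm (- x) = enorm x.
Proof.
by apply/eqP; rewrite -(@eqrXn2 _ 2) ?enorm_ge0 // !enorm_sqr /dot !mxE !mulrNN.
Qed.

Lemma parallelogram_bounded (R : realType) (p u v x : 'rV[R]_2) :
  parallelogram p u v x -> enorm x <= enorm p + enorm u + enorm v.
Proof.
move=> [s [t [/andP[s0 s1] /andP[t0 t1] ->]]].
apply: (le_trans (enormD _ _)); rewrite enormZ //; apply: lerD; last first.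
  by rewrite ler_piMl ?enorm_ge0 // ltW.
apply: (le_trans (enormD _ _)); rewrite enormZ // lerD2l.
by rewrite ler_piMl ?enorm_ge0 // ltW.
Qed.

(** Sending a point of the grid spanned by the sides of the parallelogram to the
    lattice vertex whose cell contains it moves points by a bounded amount, and
    is injective since a parallelogram contains only one point of any translate
    of the grid spanned by its sides. *)
Lemma tiling_disc_count (R : realType) (p u v u' v' : 'rV[R]_2) (r : R) :
  area u v != 0 -> area u' v' != 0 ->
  fundamental_domain (grid u v) (parallelogram p u' v') -> 0 < r ->
  (cnt (grid u' v' `&` disc r) <=
   cnt (grid u v `&` disc (r + (enorm p + enorm u' + enorm v'))))%N.
Proof.
move=> uv uv' fd r0.
have C0 : 0 <= enorm p + enorm u' + enorm v' by rewrite !addr_ge0 ?enorm_ge0.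
have /choice[g gP] : forall x, exists t,
    grid u v t /\ parallelogram p u' v' (x - t).
  by move=> x; have [t [tP _]] := fd x; exists t; rewrite -[grid u v]translations_grid.
have [fin' _] := grid_disc_count uv' r0.
rewrite -(@cnt_image _ _ g _ fin'); last first.
  move=> x y /set_mem[[a _ <-] _] /set_mem[[b _ <-] _] gab.
  have [_ Pa] := gP (comb u' v' a); have [_ Pb] := gP (comb u' v' b).
  rewrite -gab in Pb; have [s [t xp]] := coordinates (- g (comb u' v' a) - p) uv'.
  have cell c : parallelogram p u' v' (comb u' v' c - g (comb u' v' a)) ->
      (- c.1, - c.2) = (Num.floor s, Num.floor t).
    by move=> ?; apply/(parallelogram_floor _ uv' xp); rewrite combN opprK addrC.
  have [/oppr_inj e1 /oppr_inj e2] := etrans (cell a Pa) (esym (cell b Pb)).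
  by rewrite [a]surjective_pairing [b]surjective_pairing e1 e2.
have rC : 0 < r + (enorm p + enorm u' + enorm v') by lra.
apply: cnt_le; first by case: (grid_disc_count uv rC).
move=> _ [x [_ xr] <-]; have [gx Px] := gP x; split=> //; rewrite /disc /=.
have -> : g x = x + - (x - g x) by rewrite opprB subrKC.
apply: (le_trans (enormD _ _)); rewrite enormN; apply: lerD => //.
exact: parallelogram_bounded.
Qed.

(** The sides of a parallelogram that is a fundamental domain need not be
    lattice vectors, so that its area cannot be read off a change of basis.
    Instead, the densities of the two grids are compared in large discs. *)
Lemma area_fundamental (R : realType) (p u v u' v' : 'rV[R]_2) :
  area u v != 0 -> area u' v' != 0 ->
  fundamental_domain (grid u v) (parallelogram p u' v') ->
  area u v <= area u' v'.
Proof.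
move=> uv uv' fd; have A0 := area_gt0 uv; have A0' := area_gt0 uv'.
rewrite leNgt; apply/negP => AA.
pose C := enorm p + enorm u' + enorm v'.
have C0 : 0 <= C by rewrite !addr_ge0 ?enorm_ge0.
pose k := 2 / enorm u + 2 / (area u v / enorm u).
pose k' := 2 / enorm u' + 2 / (area u' v' / enorm u').
have k0 : 0 <= k by rewrite addr_ge0 ?divr_ge0 ?enorm_ge0 // ltW.
have k0' : 0 <= k' by rewrite addr_ge0 ?divr_ge0 ?enorm_ge0 // ltW.
have p0 := @pi_gt0 R.
have q0 : 0 < pi / area u v by rewrite divr_gt0.
have dlt : 0 < pi / area u' v' - pi / area u v.
  by rewrite subr_gt0 ltr_pM2l // ltf_pV2.
(* B r bounds all the error terms, and r is chosen so that they do not suffice *)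
pose B := k' + 3 + pi / area u v * (2 * C + C ^+ 2) + k * (1 + C) + 3.
have B0 : 0 <= B.
  have H1 : 0 <= pi / area u v * (2 * C + C ^+ 2).
    by apply: mulr_ge0; [exact: ltW | nra].
  have H2 : 0 <= k * (1 + C) by apply: mulr_ge0 => //; lra.
  rewrite /B; lra.
pose r := 1 + B / (pi / area u' v' - pi / area u v).
have r1 : 1 <= r by rewrite lerDl divr_ge0 // ltW.
have r0 : 0 < r by lra.
have rC : 0 < r + C by lra.
have Br : B < (pi / area u' v' - pi / area u v) * r.
  by rewrite mulrDr mulrCA divff ?gt_eqF // !mulr1 ltrDr.
have [_] := grid_disc_count uv' r0; have [_] := grid_disc_count uv rC.
have : ((cnt (grid u' v' `&` disc r))%:R : R) <= (cnt (grid u v `&` disc (r + C)))%:R.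
  by rewrite ler_nat; apply: tiling_disc_count.
rewrite (_ : 2 * (r + C) / _ + _ = k * (r + C)); last by rewrite /k; ring.
rewrite (_ : 2 * r / _ + _ = k' * r); last by rewrite /k'; ring.
rewrite ![pi * _ / _]mulrAC !ler_norml => c12 /andP[_ c2] /andP[c1 _].
suff : (pi / area u' v' - pi / area u v) * r ^+ 2 <= B * r.
  by rewrite expr2 mulrA ler_pM2r // leNgt Br.
have H1 : 0 <= pi / area u v * C ^+ 2 * (r - 1).
  by rewrite mulr_ge0 ?subr_ge0 // mulr_ge0 ?sqr_ge0 // ltW.
have H2 : 0 <= k * C * (r - 1) by rewrite mulr_ge0 ?subr_ge0 // mulr_ge0.
rewrite /B; lra.
Qed.

(** * The maximum over all lattices *)

(** A lattice containing the origin is the group spanned by its basis, and the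
    parallelogram on that basis is a fundamental domain, so that the area
    condition applies to it. *)
Lemma lattices_grid (R : realType) (d : R) (L : set 'rV[R]_2) : 1 <= d ->
  lattices d L ->
  exists u v, [/\ L = grid u v, area u v != 0, unit_separated L &
    d ^+ 2 * Num.sqrt 3 <= area u v].
Proof.
move=> d1 [[p [u [v [uv LE]]]] dist fund L0]; exists u, v.
have LG : L = grid u v.
  move: L0; rewrite LE => -[m0 [n0 p0]].
  have pE : p = comb u v (- m0, - n0).
    by rewrite (combN u v (m0, n0)) /comb /=; apply/eqP;
       rewrite -addr_eq0 addrA -p0.
  apply/seteqP; split=> [_ [m [n ->]]|x gx].
    by rewrite -addrA; apply: gridD; [rewrite pE; eexists | exists (m, n)].
  have [[m n] _ mn] : grid u v (x - p).
    by apply: gridD => //; apply: gridN; rewrite pE; eexists.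
  by exists m, n; rewrite -addrA -[u *~ m + _]/(comb u v (m, n)) mn subrKC.
split=> //.
  move=> x Lx x0; apply: (le_trans d1).
  by have := dist x 0 Lx L0 x0; rewrite subr0.
by apply: (fund 0) => //; rewrite LG; apply: fundamental_basis.
Qed.

Definition rect_u (R : realType) (d : R) : 'rV[R]_2 :=
  \row_i (if i == 0 then d else 0).

Definition rect_v (R : realType) (d : R) : 'rV[R]_2 :=
  \row_i (if i == 0 then 0 else d * Num.sqrt 3).

Lemma rect_area (R : realType) (d : R) :
  area (rect_u d) (rect_v d) = d ^+ 2 * Num.sqrt 3.
Proof.
rewrite areaE !mxE /= mul0r subr0 mulrA -expr2 ger0_norm //.
by rewrite mulr_ge0 ?sqr_ge0 ?sqrtr_ge0.
Qed.

(** The lattice spanned by (d, 0) and (0, d sqrt 3) has the least area that is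
    allowed, so it is asymptotically optimal. *)
Lemma rect_lattices (R : realType) (d : R) : 1 <= d ->
  lattices d (grid (rect_u d) (rect_v d)).
Proof.
move=> d1; have s3 : 0 < Num.sqrt 3 :> R by rewrite sqrtr_gt0.
have d2 : 0 < d ^+ 2 by rewrite exprn_gt0 //; lra.
have A0 : area (rect_u d) (rect_v d) != 0.
  by rewrite rect_area gt_eqF // mulr_gt0.
split; last exact: grid0.
- exists 0, (rect_u d), (rect_v d); split=> //; apply/seteqP; split.
    by move=> _ [[m n] _ <-]; exists m, n; rewrite add0r.
  by move=> _ [m [n ->]]; exists (m, n) => //; rewrite add0r.
- move=> x y Lx Ly; rewrite -subr_eq0.
  have [z _ <-] := gridD Lx (gridN Ly) => z0.
  rewrite -ler_sqr ?nnegrE ?enorm_ge0 //; last by lra.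
  rewrite enorm_sqr /dot !combE !mxE /= !mulr0 addr0 add0r -!expr2 !exprMn.
  rewrite sqr_sqrtr //.
  have zz : 1 <= (z.1%:~R ^+ 2 + z.2%:~R ^+ 2) :> R.
    rewrite -!rmorphXn -rmorphD /= -[1]/(1%:~R) ler_int.
    case: z z0 => m n /=.
    have [->|m0] := eqVneq m 0; have [->|n0] := eqVneq n 0; last 3 first.
    + by move=> _; nia.
    + by move=> _; nia.
    + by move=> _; nia.
    by rewrite comb0 eqxx.
  have z2 := sqr_ge0 (z.2%:~R : R); nra.
- move=> p u v uv fd; rewrite -rect_area; exact: area_fundamental fd.
Qed.

Lemma max_natP (A : set nat) (B : nat) : A !=set0 -> (forall n, A n -> (n <= B)%N) ->
  A (max_nat A) /\ forall n, A n -> (n <= max_nat A)%N.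
Proof.
move=> [n An] AB; pose P m := `[< A m >].
have exP : exists m, P m by exists n; apply/asboolP.
have ubP m : P m -> (m <= B)%N by move/asboolP; apply: AB.
case: (ex_maxnP exP ubP) => m /asboolP Am mmax.
rewrite /max_nat; case: xgetP => [k -> [Ak ubk]|/(_ m)].
  by split=> // j Aj; apply: ubk.
by case; split=> // j Aj; apply: mmax; apply/asboolP.
Qed.

Definition max_primitive (R : realType) (d r : R) : nat :=
  max_nat [set num_primitive L r | L in lattices d].

(** The upper bound holds because the expected count decreases with the area,
    the lower bound because of the rectangular lattice. *)
Lemma max_primitive_count (R : realType) (d eps : R) : 1 <= d -> 0 < eps ->
  exists M, forall r, 1 <= r ->
  `|(max_primitive d r)%:R - pi / (d ^+ 2 * Num.sqrt 3 * zeta2 R) * r ^+ 2|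
    <= eps * r ^+ 2 + M.
Proof.
move=> d1 eps0; have [M PM] := primitive_count eps0; exists M => r r1.
have p0 := @pi_gt0 R.
have Z0 : 0 < zeta2 R by have := zeta2_ge1 R; lra.
have s3 : 0 < Num.sqrt 3 :> R by rewrite sqrtr_gt0.
have d2 : 0 < d ^+ 2 by rewrite exprn_gt0 //; lra.
have up L : lattices d L -> (num_primitive L r)%:R <=
    pi / (d ^+ 2 * Num.sqrt 3 * zeta2 R) * r ^+ 2 + (eps * r ^+ 2 + M).
  move=> /(lattices_grid d1)[u [v [-> uv sep A]]].
  have := PM u v sep uv r r1; rewrite ler_norml => /andP[_].
  rewrite /primitive_error lerBlDl [pi * _ / _]mulrAC => /le_trans; apply.
  rewrite lerD2r ler_wpM2r ?sqr_ge0 // ler_pM2l //.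
  have A0 := area_gt0 uv.
  have AZ : 0 < area u v * zeta2 R by rewrite mulr_gt0.
  have dZ : 0 < d ^+ 2 * Num.sqrt 3 * zeta2 R by rewrite mulr_gt0 // mulr_gt0.
  by rewrite lef_pV2 // ler_pM2r.
have low : pi / (d ^+ 2 * Num.sqrt 3 * zeta2 R) * r ^+ 2 - (eps * r ^+ 2 + M) <=
    (num_primitive (grid (rect_u d) (rect_v d)) r)%:R.
  have rl := rect_lattices d1.
  have A0 : area (rect_u d) (rect_v d) != 0.
    by rewrite rect_area gt_eqF // mulr_gt0.
  have sep : unit_separated (grid (rect_u d) (rect_v d)).
    by have [u [v [_ _ sep _]]] := lattices_grid d1 rl.
  have := PM _ _ sep A0 r r1; rewrite ler_norml => /andP[+ _].
  by rewrite /primitive_error rect_area [pi * _ / _]mulrAC; lra.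
have [||[L dL maxE] mx] := @max_natP [set num_primitive L r | L in lattices d]
  (Num.truncn (pi / (d ^+ 2 * Num.sqrt 3 * zeta2 R) * r ^+ 2 + (eps * r ^+ 2 + M))).
- by eexists; exists (grid (rect_u d) (rect_v d)) => //; exact: rect_lattices.
- move=> _ [L dL <-]; rewrite -ltnS -(ltr_nat R).
  by apply: le_lt_trans (truncnS_gt _); exact: up.
have := up L dL; rewrite maxE -/(max_primitive d r) => upm.
have : (num_primitive (grid (rect_u d) (rect_v d)) r <= max_primitive d r)%N.
  by apply: mx; exists (grid (rect_u d) (rect_v d)) => //; exact: rect_lattices.
rewrite -(ler_nat R) => lom.
rewrite ler_norml; lra.
Qed.

Lemma max_primitive_cvg (R : realType) (d : R) : 1 <= d ->
  (max_primitive d r)%:R / r ^+ 2 @[r --> +oo] -->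
  pi / (d ^+ 2 * Num.sqrt 3 * zeta2 R).
Proof.
move=> d1; apply/cvgrPdist_lt => eps eps0.
have e2 : 0 < eps / 2 by rewrite divr_gt0.
have [M HM] := max_primitive_count d1 e2.
near=> r.
have r1 : 1 <= r by near: r; apply: nbhs_pinfty_ge; exact: num_real.
have rM : 2 * `|M| / eps < r by near: r; apply: nbhs_pinfty_gt; exact: num_real.
have r2 : 0 < r ^+ 2 by rewrite exprn_gt0 //; lra.
have := HM r r1; set c := pi / _; set m : R := _%:R => H.
have -> : c - m / r ^+ 2 = - ((m - c * r ^+ 2) / r ^+ 2).
  by field; rewrite gt_eqF //; lra.
rewrite normrN normrM normfV (gtr0_norm r2) ltr_pdivrMr //.
apply: (le_lt_trans H).
suff : M < eps / 2 * r ^+ 2 by lra.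
apply: (le_lt_trans (ler_norm M)).
move: rM; rewrite ltr_pdivrMr // => rM.
have : eps * r <= eps * r ^+ 2 by rewrite ler_pM2l //; nra.
have := normr_ge0 M; lra.
Unshelve. all: by end_near.
Qed.

(** * The limit *)

Theorem theorem3p5 (R : realType) (d : R) (hd : 1 <= d) :
  exists2 l : R,
    N g d / (4 * Num.sqrt 3 * (g + 2^-1) ^+ 2 * pi) @[g --> +oo] --> l
    & l <= 1.
Proof.
have p0 := @pi_gt0 R.
have Z0 : 0 < zeta2 R by have := zeta2_ge1 R; lra.
have s3 : 0 < Num.sqrt 3 :> R by rewrite sqrtr_gt0.
have d2 : 1 <= d ^+ 2 by rewrite exprn_ege1.
exists (pi ^+ 2 / (6 * d ^+ 2 * zeta2 R)); last first.
  rewrite ler_pdivrMr ?mul1r; last by rewrite mulr_gt0 // mulr_gt0 //; lra.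
  have := zeta2_ge R; nra.
have cvg_r : 2 * g * pi @[g --> (+oo : set_system R)] --> +oo.
  apply/cvgryPge => A; near=> g.
  have gA : A / (2 * pi) <= g by near: g; apply: nbhs_pinfty_ge; exact: num_real.
  by move: gA; rewrite ler_pdivrMr ?mulr_gt0 // mulrCA mulrA.
have cvg_shift : (g + 2^-1)^-1 @[g --> (+oo : set_system R)] --> 0.
  apply/cvgrPdist_lt => eps eps0; near=> g.
  have g0 : 0 < g by near: g; apply: nbhs_pinfty_gt; exact: num_real.
  have ge : eps^-1 < g by near: g; apply: nbhs_pinfty_gt; exact: num_real.
  rewrite sub0r normrN gtr0_norm ?invr_gt0; last by lra.
  rewrite -[eps]invrK ltf_pV2 ?posrE ?invr_gt0 //; lra.
(* 1 - 1 / (2 (g + 1/2)) is g / (g + 1/2) *)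
have cvg_base :
    1 - 2^-1 * (g + 2^-1)^-1 @[g --> (+oo : set_system R)] --> (1 : R).
  rewrite -[X in _ --> X](_ : 1 - 2^-1 * 0 = _ :> R); last by rewrite mulr0 subr0.
  by apply: cvgB; [exact: cvg_cst | apply: cvgM => //; exact: cvg_cst].
have lim : pi / (2 * Num.sqrt 3) *
    ((max_primitive d (2 * g * pi))%:R / (2 * g * pi) ^+ 2 *
     ((1 - 2^-1 * (g + 2^-1)^-1) * (1 - 2^-1 * (g + 2^-1)^-1)))
    @[g --> (+oo : set_system R)] -->
    pi / (2 * Num.sqrt 3) * (pi / (d ^+ 2 * Num.sqrt 3 * zeta2 R) * (1 * 1)).
  apply: cvgM; first exact: cvg_cst.
  apply: cvgM; last exact: cvgM.
  exact: (cvg_comp _ _ cvg_r (max_primitive_cvg hd)).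
have lE : pi / (2 * Num.sqrt 3) * (pi / (d ^+ 2 * Num.sqrt 3 * zeta2 R) * (1 * 1)) =
  pi ^+ 2 / (6 * d ^+ 2 * zeta2 R).
  have s33 : Num.sqrt 3 ^+ 2 = 3 :> R by rewrite sqr_sqrtr.
  have -> : 6 * d ^+ 2 * zeta2 R = 2 * Num.sqrt 3 ^+ 2 * d ^+ 2 * zeta2 R.
    by rewrite s33; ring.
  move: p0; move: (pi : R) => p p0; field.
  by rewrite !gt_eqF //; lra.
rewrite -lE; apply: cvg_trans lim; apply: near_eq_cvg; near=> g.
have g0 : 0 < g by near: g; apply: nbhs_pinfty_gt; exact: num_real.
rewrite /= /N -/(max_primitive d (2 * g * pi)).
move: (max_primitive _ _)%:R => m.
move: p0; move: (pi : R) => p p0; field.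
rewrite !gt_eqF //; lra.
Unshelve. all: by end_near.
Qed.
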